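(* For every $s\ge 0$ and every $x\in\mathbb R$, $$\mathbb P\Big(\beta_s(x)<\infty\ \text{ or }\ \lim_{t\to\infty}X_{s,t}(x)=0\Big)=1,$$ i.e. almost surely, either the solution started at $(s,x)$ blows up in finite time or it converges to $0$.
   Context: Let $W$ be a standard one-dimensional Wiener process on a probability space $(\Omega,\mathcal F,\mathbb P)$ with $W(0)=0$, and let $\sigma>0$. For $s\ge 0$ and $x\in\mathbb R$, let $X_{s,t}(x)$, $t\ge s$, denote the unique local solution of the stochastic differential equation $$dX(t)=X(t)\big(X(t)-t\big)\,dt+\sigma\,dW(t),\quad t\ge s,\qquad X(s)=x.$$ The blow-up time is $\beta_s(x):=\lim_{n\to\infty}\inf\{t>s:\ |X_{s,t}(x)|\ge n\}\in(s,\infty]$. Solutions can only blow up to $+\infty$, and one sets $X_{s,t}(x)=\infty$ for $t\ge\beta_s(x)$. *)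

(* Defs.v *)
From mathcomp Require Import all_boot all_order all_algebra.
From mathcomp Require Import all_classical all_reals all_analysis.
Import Order.TTheory GRing.Theory Num.Theory numFieldNormedType.Exports.

Set Implicit Arguments.
Unset Strict Implicit.
Unset Printing Implicit Defensive.

Local Open Scope classical_set_scope.
Local Open Scope ring_scope.

(* Time is indexed by all of R; only the values W t with 0 <= t matter.
   Initial value and path continuity are only required almost surely.
   Independence of the increments is the product rule for arbitrary finite
   families of consecutive increments (taking some B i to be setT covers the
   subfamilies). *)
Definition is_wiener d (T : measurableType d) (R : realType)
    (P : probability T R) (W : R -> {RV P >-> R}) : Prop :=
  [/\ {ae P, forall w, W 0 w = 0},
      {ae P, forall w, {within `[0, +oo[, continuous (fun t => W t w)}},
      forall s t : R, 0 <= s -> s < t ->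
        forall B : set R, measurable B ->
          P [set w | B (W t w - W s w)] = normal_prob 0 (Num.sqrt (t - s)) B
    & forall (n : nat) (t : nat -> R) (B : nat -> set R),
        0 <= t 0%N -> (forall i, (i < n)%N -> t i <= t i.+1) ->
        (forall i, measurable (B i)) ->
        P [set w | forall i, (i < n)%N -> B i (W (t i.+1) w - W (t i) w)] =
        (\prod_(i < n) P [set w | B i (W (t i.+1) w - W (t i) w)%R])%E].

(* A path X : R -> \bar R takes finite values where the local solution is
   defined and +oo from the blow-up time on. The hitting times range over the
   times at which the solution is defined, so the value +oo used after blow-up
   does not itself count as a hit; ereal_inf set0 = +oo. *)
Definition blowup_time (R : realType) (s : R) (X : R -> \bar R) : \bar R :=
  limn (fun n : nat => ereal_inf
    [set t%:E | t in [set t : R |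
      [/\ s < t, X t \is a fin_num & n%:R <= `|fine (X t)|]]]).

(* X is the maximal local solution, along the driving path w, of
     dX = X (X - t) dt + sigma dw  for t >= s,   X s = x,
   on [s, beta) with beta its blow-up time, extended by +oo. The noise is
   additive, so the stochastic equation in integral form is a pathwise
   identity. A solution artificially stopped (set to +oo) before it explodes
   is ruled out: its blowup_time would be +oo, so it would have to be finite at
   all times. *)
Definition is_solution (R : realType) (sigma : R) (w : R -> R) (s x : R)
    (X : R -> \bar R) : Prop :=
  let beta := blowup_time s X in
  [/\ (s%:E < beta)%E,
      forall t : R, s <= t -> (t%:E < beta)%E -> X t \is a fin_num,
      {within [set t : R | s <= t /\ (t%:E < beta)%E],
        continuous (fun t => fine (X t))},
      forall t : R, s <= t -> (t%:E < beta)%E ->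
        fine (X t) =
          x + (\int[lebesgue_measure]_(u in `[s, t])
                 (fine (X u) * (fine (X u) - u)))
            + sigma * (w t - w s)
    & forall t : R, (beta <= t%:E)%E -> X t = +oo%E].

(* Main.v *)
(* Pathwise, a solution that never explodes can only do two things for large t:
   once it is below t - 1 it is pulled to 0, and once it is above t + 1 the gap
   v = x - t satisfies roughly v' >= v^2/4 and explodes; so it tends to 0 or stays within
   distance 1 of the diagonal x = t.  This only needs that Brownian increments
   over late windows of length 1/t are uniformly small, which follows from
   Gaussian tails, Borel-Cantelli and chaining.

   The diagonal is unstable, hence for a given path at most one solution can
   stay near it, and the event that it does must be shown to be null.  Being
   trapped near the diagonal is expressed through Euler schemes, which makes it
   a measurable event in the increments of W.  Adding the drifts
   c min(t - s, 1), 0 < c <= 1, to W turns it into pairwise disjoint events; by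
   the Cameron-Martin formula their probabilities are bounded below by the same
   quantity, positive unless the original event is null. *)

(* The family [X] is given only along the paths of W itself and carries no measurability in the
   sample point. So the behaviour of [X] near the diagonal is not known to be an event, nor can it
   be evaluated along a path with a drift added. The Euler scheme is a functional of an arbitrary
   path and settles both points. The link is one inclusion: a solution that stays near the diagonal
   makes its driving path [trapped].

   Disjointness rests on x (x - t) - y (y - t) = (x - y) (x + y - t), which the scheme reproduces
   exactly at each step. Near the diagonal x + y - t is about t, so any gap is amplified, and two
   different drifts create a gap although both schemes start at the same point.

   For 0 <= c <= 1 and Z = W (s + 1) - W s, the density exp(c Z - c^2 / 2) is at least exp(-|Z| -
   1/2). The common lower bound is the integral of the latter over the trapped event. The drifts c =
   1 / (i + 1) give infinitely many disjoint events, so this integral is 0; its integrand is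
   positive, so the event is null. *)
Require Import Defs.
From mathcomp Require Import all_boot all_order all_algebra.
From mathcomp Require Import all_classical all_reals all_analysis.
From mathcomp Require Import measurable_realfun ring lra.
Import Order.TTheory GRing.Theory Num.Theory numFieldNormedType.Exports.

Set Implicit Arguments.
Unset Strict Implicit.
Unset Printing Implicit Defensive.

Local Open Scope classical_set_scope.
Local Open Scope ring_scope.

(** * Crossing and barrier lemmas *)

Section crossing.
Context {R : realType}.
Implicit Types (g x v : R -> R) (a b s t u T : R).

(** Continuity on a closed half-line, one-sided at [s]: nothing is known about a solution before its
    starting time, nor about W before 0. *)
Definition cont_from s g := forall t, s <= t -> forall e, 0 < e ->
  exists2 d, 0 < d & forall u, s <= u -> `|u - t| < d -> `|g u - g t| < e.

Lemma cont_fromW s t g : s <= t -> cont_from s g -> cont_from t g.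
Proof.
move=> st cg r tr e e0; have [d d0 H] := cg r (le_trans st tr) e e0.
by exists d => // u tu; apply: H; exact: le_trans tu.
Qed.

Lemma cont_fromN s g : cont_from s g -> cont_from s (fun u => - g u).
Proof.
move=> cg r tr e e0; have [d d0 H] := cg r tr e e0.
exists d => // u tu ud; have -> : - g u - - g r = - (g u - g r) by ring.
by rewrite normrN; exact: H.
Qed.

Lemma cont_from_affine s a b : cont_from s (fun u => a * u + b).
Proof.
move=> t st e e0; have a0 : 0 < `|a| + 1 by have := normr_ge0 a; lra.
exists (e / (`|a| + 1)); first by rewrite divr_gt0.
move=> u su; rewrite ltr_pdivlMr// => ud.
have -> : a * u + b - (a * t + b) = (u - t) * a by ring.
by rewrite normrM (le_lt_trans _ ud)// ler_wpM2l//; lra.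
Qed.

Lemma cont_fromD s g h : cont_from s g -> cont_from s h ->
  cont_from s (fun u => g u + h u).
Proof.
move=> cg ch t st e e0; have e20 : 0 < e / 2 by lra.
have [d d0 H] := cg t st _ e20; have [d' d'0 H'] := ch t st _ e20.
exists (Num.min d d'); first by rewrite lt_min d0.
move=> u su; rewrite lt_min => /andP[/(H u su) A /(H' u su) B].
have -> : g u + h u - (g t + h t) = (g u - g t) + (h u - h t) by ring.
by rewrite (le_lt_trans (ler_normD _ _))//; lra.
Qed.

Lemma first_hit g a b c : a <= b -> cont_from a g -> g a <= c -> c <= g b ->
  exists t, [/\ a <= t, t <= b, g t = c & forall u, a <= u -> u <= t -> g u <= c].
Proof.
move=> ab cg ga gb.
pose S := [set u | [/\ a <= u, u <= b & c <= g u]].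
have Sb : S b by [].
have lS : lbound S a by move=> u [].
have hS : has_inf S by split; [exists b | exists a].
set t := inf S.
have at_ : a <= t by apply: lb_le_inf => //; exists b.
have tb : t <= b by apply: ge_inf => //; exists a.
have ct : c <= g t.
  rewrite leNgt; apply/negP => gtc.
  have [d d0 H] := cg t at_ (c - g t) ltac:(lra).
  have [u [au ub cu] ut] := inf_adherent d0 hS.
  have tu : t <= u by apply: ge_inf; [exists a | split].
  have := H u au; rewrite ger0_norm ?subr_ge0// => /(_ ltac:(rewrite /t; lra)).
  by rewrite ltr_norml => /andP[]; lra.
have lt_t u : a <= u -> u < t -> g u < c.
  move=> au ut; rewrite ltNge; apply/negP => cu.
  have : t <= u by apply: ge_inf; [exists a | split => //; lra].
  lra.
have gtc : g t <= c.
  have [->|/eqP ta] := eqVneq t a; first by [].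
  rewrite leNgt; apply/negP => gtc.
  have [d d0 H] := cg t at_ (g t - c) ltac:(lra).
  pose u := Num.max a (t - d / 2).
  have au : a <= u by rewrite le_max lexx.
  have ut : u < t by rewrite gt_max; apply/andP; split; [rewrite lt_neqAle at_ eq_sym;
    move/eqP: ta => ->|lra].
  have tdu : t - d / 2 <= u by rewrite le_max lexx orbT.
  have := H u au; rewrite ltr0_norm ?subr_lt0// => /(_ ltac:(lra)).
  have := lt_t u au ut.
  by rewrite ltr_norml => ? /andP[]; lra.
exists t; split => //; first lra.
move=> u au; rewrite le_eqVlt => /predU1P[->//|ut]; exact/ltW/lt_t.
Qed.

Lemma last_hit g a b c : a <= b -> cont_from a g -> g a <= c -> c <= g b ->
  exists t, [/\ a <= t, t <= b, g t = c & forall u, t <= u -> u <= b -> c <= g u].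
Proof.
move=> ab cg ga gb.
(* Time reversal on [a, b] turns a last visit into a first one. For u > b the clamp at [a] keeps the
   argument in the half-line where [g] is continuous. *)
pose h u := - g (Num.max a (a + b - u)).
have ch : cont_from a h.
  move=> t at_ e e0; have [|d d0 H] := cg (Num.max a (a + b - t)) _ e e0.
    by rewrite le_max lexx.
  exists d => // u au ud; rewrite /h.
  have -> p q : - g p - - g q = - (g p - g q) by ring.
  rewrite normrN.
  apply: H; first by rewrite le_max lexx.
  rewrite (le_lt_trans _ ud)//.
  rewrite /Num.max; case: ltP => A; case: ltP => B; rewrite ler_norml -lerBlDr;
   case: (lerP u t) => C; rewrite ?(ler0_norm (x := u - t)) ?(gtr0_norm (x := u - t)); lra.
have := @first_hit h a b (- c) ab ch.
rewrite /h.
have -> : a + b - a = b by ring.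
have -> : a + b - b = a by ring.
rewrite maxxx (max_idPr ab) => /(_ ltac:(lra) ltac:(lra)) [t [at_ tb htc H]].
have E u : a <= u -> u <= b -> Num.max a (a + b - u) = a + b - u.
  by move=> au ub; apply/max_idPr; lra.
exists (a + b - t); split; [lra|lra| |].
  by move: htc; rewrite E// => /oppr_inj.
move=> u tu ub; have := H (a + b - u) ltac:(lra) ltac:(lra).
have -> : Num.max a (a + b - (a + b - u)) = u by rewrite E; [ring|lra|lra].
lra.
Qed.

(** Take the first passage at [d], then the last visit of [c] before it. *)
Lemma crossing g a b c d : a <= b -> cont_from a g -> g a <= c -> c <= d -> d <= g b ->
  exists t1 t2, [/\ a <= t1, t1 <= t2, t2 <= b, (g t1 = c /\ g t2 = d) &
    forall u, t1 <= u -> u <= t2 -> c <= g u /\ g u <= d].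
Proof.
move=> ab cg ga cd gb.
have [|t2 [at2 t2b gt2 H2]] := @first_hit g a b d ab cg _ gb; first exact: le_trans cd.
have [|t1 [at1 t12 gt1 H1]] := @last_hit g a t2 c at2 cg ga; first by rewrite gt2.
exists t1, t2; split => // u tu ut; split; first exact: H1.
apply: H2 => //; exact: le_trans tu.
Qed.

(* The [- (t2 - t1)] term makes [g] strictly lose height over unit times spent
   above [a]. *)
Lemma barrier_stay g T a b d : cont_from T g -> a <= b -> d < b - a -> d < 1 ->
  (forall t1 t2, T <= t1 -> t1 <= t2 -> t2 <= t1 + 1 ->
    (forall u, t1 <= u -> u <= t2 -> a <= g u /\ g u <= b) ->
    g t2 - g t1 <= d - (t2 - t1)) ->
  g T <= a -> forall u, T <= u -> g u < b.
Proof.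
move=> cg ab dab d1 H gT u Tu; rewrite ltNge; apply/negP => bg.
have [t1 [t2 [Tt1 t12 t2u [g1 g2] B]]] := crossing Tu cg gT ab bg.
have [le1|gt1] := lerP t2 (t1 + 1).
  by have := H t1 t2 Tt1 t12 le1 B; lra.
(* A crossing longer than one unit is cut after its first unit, where [g] would already be below [a]
   because d < 1. *)
have := H t1 (t1 + 1) Tt1 ltac:(lra) (lexx _).
have [+ _] := B (t1 + 1) ltac:(lra) ltac:(lra).
move=> ? /(_ ltac:(by move=> r ? ?; apply: B; lra)); lra.
Qed.

(** If [g] stayed above [a], every unit of time would cost it at least 1 - d. *)
Lemma barrier_hit g T a d : d < 1 ->
  (forall t1 t2, T <= t1 -> t1 <= t2 -> t2 <= t1 + 1 ->
    (forall u, t1 <= u -> u <= t2 -> a <= g u) ->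
    g t2 - g t1 <= d - (t2 - t1)) ->
  exists2 u, T <= u & g u <= a.
Proof.
move=> d1 H; apply: contrapT => N.
have A u : T <= u -> a <= g u.
  by move=> Tu; rewrite leNgt; apply/negP => /ltW gu; apply: N; exists u.
have B k : g (T + k%:R) <= g T - k%:R * (1 - d).
  elim: k => [|k IH]; first by rewrite addr0; lra.
  have k0 : 0 <= k%:R :> R by [].
  have := H (T + k%:R) (T + k.+1%:R).
  rewrite -natr1 => /(_ ltac:(lra) ltac:(lra) ltac:(lra)).
  move=> /(_ ltac:(move=> u ? ?; apply: A; lra)); lra.
have := archi_boundP (x := `|(g T - a) / (1 - d)|) (normr_ge0 _).
set k := Num.bound _ => hk.
have := B k; have := A (T + k%:R) ltac:(have : 0 <= k%:R :> R by []; lra).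
move: hk => /(le_lt_trans (ler_norm _)).
rewrite ltr_pdivrMr; lra.
Qed.

Lemma barrier_trap g T a b d : cont_from T g -> a <= b -> d < b - a -> d < 1 ->
  (forall t1 t2, T <= t1 -> t1 <= t2 -> t2 <= t1 + 1 ->
    (forall u, t1 <= u -> u <= t2 -> a <= g u) ->
    g t2 - g t1 <= d - (t2 - t1)) ->
  exists2 T', T <= T' & forall u, T' <= u -> g u < b.
Proof.
move=> cg ab dab d1 H.
have [T' TT' gT'] := barrier_hit d1 H.
exists T' => //; apply: (@barrier_stay g T' a b d) => //.
  exact: cont_fromW TT' cg.
move=> t1 t2 T1 t12 t21 B; apply: H => //; first exact: le_trans T1.
by move=> u ? ?; case: (B u).
Qed.

End crossing.

(** * Long-time behaviour of a global solution along a tame path *)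

Section dichotomy.
Context {R : realType}.
Variables (s : R) (x v : R -> R).

(** The noise moves by order e over a window of length 1/t. Away from 0 and from the diagonal the
    drift has order t and outweighs the part e t (u - t); the additive e is absorbed by the width of
    a barrier. *)
Definition tame := forall e, 0 < e -> exists T0, 0 < T0 /\
  forall t u, T0 <= t -> t <= u -> u <= 2 * t -> `|v u - v t| <= e * (1 + t * (u - t)).

Definition drift u := x u * (x u - u).

(* Integral form of [dx = x (x - u) du + dv], reduced to the two estimates that
   are used. *)
Definition solves := cont_from s x /\
  (forall t1 t2 m, s <= t1 -> t1 <= t2 ->
    (forall u, t1 <= u -> u <= t2 -> m <= drift u) ->
    m * (t2 - t1) <= x t2 - x t1 - (v t2 - v t1)) /\
  (forall t1 t2 m, s <= t1 -> t1 <= t2 ->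
    (forall u, t1 <= u -> u <= t2 -> drift u <= m) ->
    x t2 - x t1 - (v t2 - v t1) <= m * (t2 - t1)).

Hypothesis (xv : solves) (tv : tame) (cv : cont_from s v).

Let lo := xv.2.1.
Let up := xv.2.2.
Let cx := xv.1.

(** Let [y] be the gap to the diagonal with the noise since T removed. It rises fast enough to
    dominate the noise, so x - u >= y / 2 and y' >= y^2 / 4. This explodes before T + 12 <= 2 T,
    whereas [x] is finite. *)
Lemma above_diagonal_absurd : exists T0, forall T, T0 <= T -> x T <= T + 1.
Proof.
have [T0 [T00 H0]] := tv (e := 1/16) ltac:(lra).
exists (Num.max s (Num.max T0 32)) => T.
rewrite !ge_max => /andP[sT /andP[T0T T32]].
rewrite leNgt; apply/negP => xT.
have N u : T <= u -> u <= 2 * T -> - (1 + T * (u - T)) / 16 <= v u - v T <=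
  (1 + T * (u - T)) / 16.
  by move=> Tu uT; have := H0 T u T0T Tu uT; rewrite ler_norml; lra.
pose y u := x u + - v u + - u + v T.
have cG : cont_from T (fun u => T * (u - T) / 8 - y u).
  rewrite (_ : (fun u => _) = fun u => - x u + v u + ((1 + T / 8) * u + - (v T +
    T * T / 8))).
    apply: (cont_fromW sT); apply: cont_fromD; last exact: cont_from_affine.
    by apply: cont_fromD; [exact: cont_fromN|].
  by apply/funext => u; rewrite /y; ring.
(* This floor is at least twice the noise bound at all times, whence x - u >= y / 2 below. *)
have G u : T <= u -> u <= 2 * T -> 1/2 + T * (u - T) / 8 <= y u.
  move=> Tu uT; rewrite leNgt; apply/negP => yu.
  have [||t [Tt tu yt H]] := first_hit (c := - (1/2)) Tu cG.
  - by rewrite /y; lra.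
  - lra.
  have : 0 * (t - T) <= 0 by lra.
  have := @lo T t (T / 8 + 1) sT Tt.
  have D r : T <= r -> r <= t -> T / 8 + 1 <= drift r.
    move=> Tr rt; have := H r Tr rt; have /andP[n1 n2] := N r Tr ltac:(lra).
    have p0 : 0 <= T * (r - T) by apply: mulr_ge0; lra.
    move=> h; have xr : 7 / 16 <= x r - r by move: h; rewrite /y; lra.
    have : 7 / 16 * T <= x r * (x r - r) by rewrite mulrC ler_pM; lra.
    rewrite /drift; lra.
  move=> /(_ D); move: yt; rewrite /y; lra.
have G' u : T <= u -> u <= 2 * T -> 1/2 <= y u.
  move=> Tu uT; have := G u Tu uT; have : 0 <= T * (u - T) by apply: mulr_ge0; lra.
  lra.
(* The extra 1 in the drift bound pays for the term - u of [y]; the slack comes from A T >= 16. *)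
have L t1 t2 : T <= t1 -> t1 <= t2 -> t2 <= 2 * T -> forall A, 1/2 <= A ->
    (forall u, t1 <= u -> u <= t2 -> A <= y u) ->
    A ^+ 2 / 4 * (t2 - t1) <= y t2 - y t1.
  move=> Tt1 t12 t2T A A0 HA.
  have D r : t1 <= r -> r <= t2 -> A ^+ 2 / 4 + 1 <= drift r.
    move=> Tr rt; have h := HA r Tr rt; have g := G r ltac:(lra) ltac:(lra).
    have /andP[n1 n2] := N r ltac:(lra) ltac:(lra).
    have p0 : 0 <= T * (r - T) by apply: mulr_ge0; lra.
    have xr : y r / 2 <= x r - r by rewrite /y in g *; lra.
    have a1 : A / 2 * (A / 2 + T) <= x r * (x r - r) by rewrite mulrC ler_pM; lra.
    have : 1/2 * 32 <= A * T by rewrite ler_pM; lra.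
    rewrite /drift expr2; lra.
  have := @lo t1 t2 (A ^+ 2 / 4 + 1) ltac:(lra) t12 D.
  rewrite /y; lra.
have M t1 t2 : T <= t1 -> t1 <= t2 -> t2 <= 2 * T -> y t1 <= y t2.
  move=> Tt1 t12 t2T; have := L t1 t2 Tt1 t12 t2T (1/2) (lexx _).
  move=> /(_ ltac:(move=> u ? ?; apply: G'; lra)); lra.
have L2 t1 t2 : T <= t1 -> t1 <= t2 -> t2 <= 2 * T ->
    (y t1) ^+ 2 / 4 * (t2 - t1) <= y t2 - y t1.
  move=> Tt1 t12 t2T; apply: L => //; first by apply: G'; lra.
  by move=> u ? ?; apply: M; lra.
(* While y >= 3^k, a time 8 / 3^k adds at least 2 y and so triples [y]; these times sum to 12. *)
have K k : exists t, [/\ T <= t, t <= T + 12 - 12 * 3^-1 ^+ k & 3 ^+ k <= y t].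
  elim: k => [|k [t [Tt tk yt]]].
    by exists T; rewrite !expr0; split; rewrite /y; lra.
  have p0 : 0 < (3^-1 : R) ^+ k by rewrite exprn_gt0.
  have pq : (3 : R) ^+ k * 3^-1 ^+ k = 1 by rewrite -exprMn mulfV ?expr1n.
  exists (t + 8 * 3^-1 ^+ k); rewrite !exprSr; split; [lra|lra|].
  have := L2 t (t + 8 * 3^-1 ^+ k) Tt ltac:(lra) ltac:(lra).
  set p := 3 ^+ k in yt pq *; set q := 3^-1 ^+ k in p0 pq tk *.
  have p1 : 0 < p by rewrite exprn_gt0.
  have -> : y t ^+ 2 / 4 * (t + 8 * q - t) = 2 * (y t * q) * y t by field.
  have yq : 1 <= y t * q by rewrite -pq ler_wpM2r// ltW.
  have : 1 * p <= y t * q * y t by rewrite ler_pM//; lra.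
  lra.
have B k : 3 ^+ k <= y (T + 12).
  have [t [Tt tk yt]] := K k; apply: (le_trans yt); apply: M; rewrite //; last lra.
  have : 0 < (3^-1 : R) ^+ k by rewrite exprn_gt0.
  lra.
have E k : k%:R <= (3 : R) ^+ k.
  elim: k => [|k IH]; first by rewrite expr0.
  have k0 : 0 <= k%:R :> R by [].
  have : 1 <= (3 : R) ^+ k by rewrite exprn_ege1//; lra.
  rewrite exprSr -(natr1 k); lra.
have := archi_boundP (x := `|y (T + 12)|) (normr_ge0 _).
set k := Num.bound _; have := B k; have := E k; have := ler_norm (y (T + 12)); lra.
Qed.

(** Mirror image of the argument above the diagonal. While x > 1 and the gap is at least 7/16, the
    drift is at most - T / 8; following this slope for 32 units of time would bring [x] below 1. *)
Lemma below_diagonal_hits1 : exists T0, forall T, T0 <= T -> x T < T - 1 ->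
  exists2 u, T <= u & x u <= 1.
Proof.
have [T0 [T00 H0]] := tv (e := 1/16) ltac:(lra).
exists (Num.max s (Num.max T0 32)) => T.
rewrite !ge_max => /andP[sT /andP[T0T T32]] xT.
have N u : T <= u -> u <= 2 * T -> - (1 + T * (u - T)) / 16 <= v u - v T <=
  (1 + T * (u - T)) / 16.
  by move=> Tu uT; have := H0 T u T0T Tu uT; rewrite ler_norml; lra.
apply: contrapT => A.
have x1 u : T <= u -> 1 < x u.
  by move=> Tu; rewrite ltNge; apply/negP => xu; apply: A; exists u.
pose y u := x u + - v u + - u + v T.
have cG : cont_from T (fun u => T * (u - T) / 8 + y u).
  rewrite (_ : (fun u => _) = fun u => x u + - v u + ((T / 8 - 1) * u + (v T - T * T / 8))).
    apply: (cont_fromW sT); apply: cont_fromD; last exact: cont_from_affine.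
    by apply: cont_fromD => //; exact: cont_fromN.
  by apply/funext => u; rewrite /y; ring.
have G u : T <= u -> u <= 2 * T -> y u <= - (1/2) - T * (u - T) / 8.
  move=> Tu uT; rewrite leNgt; apply/negP => yu.
  have [||t [Tt tu yt H]] := first_hit (c := - (1/2)) Tu cG.
  - by rewrite /y; lra.
  - lra.
  have D r : T <= r -> r <= t -> drift r <= - (T / 8).
    move=> Tr rt; have h := H r Tr rt; have /andP[n1 n2] := N r Tr ltac:(lra).
    have p0 : 0 <= T * (r - T) by apply: mulr_ge0; lra.
    have xr : 7 / 16 <= r - x r by move: h; rewrite /y; lra.
    have X1 := x1 r Tr.
    (* In x (r - x), the factor x is large in the first case and r - x in the second. *)
    have [h1|h1] := lerP (r / 2) (x r).
      have : T / 2 * (7/16) <= x r * (r - x r) by rewrite ler_pM//; lra.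
      rewrite /drift; lra.
    have : 1 * (T / 2) <= x r * (r - x r) by rewrite ler_pM//; lra.
    rewrite /drift; lra.
  have := up sT Tt D; move: yt; rewrite /y; lra.
have := G (T + 32) ltac:(lra) ltac:(lra).
have /andP[] := N (T + 32) ltac:(lra) ltac:(lra).
have := x1 (T + 32) ltac:(lra).
rewrite /y; lra.
Qed.

Lemma hits1_stays2 : exists T0, forall T, T0 <= T -> x T <= 1 ->
  forall u, T <= u -> x u < 2.
Proof.
have [T0 [T00 H0]] := tv (e := 1/4) ltac:(lra).
exists (Num.max s (Num.max T0 8)) => T.
rewrite !ge_max => /andP[sT /andP[T0T T32]] xT.
apply: (@barrier_stay _ x T 1 2 (1/2)) => //; [exact: cont_fromW sT cx|lra..|].
move=> t1 t2 Tt1 t12 t21 B.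
have D r : t1 <= r -> r <= t2 -> drift r <= - (t1 - 2).
  move=> tr rt; have [b1 b2] := B r tr rt.
  have : 1 * (t1 - 2) <= x r * (r - x r) by rewrite ler_pM//; lra.
  rewrite /drift; lra.
have := H0 t1 t2 ltac:(lra) t12 ltac:(lra); rewrite ler_norml => /andP[_].
have := up (le_trans sT Tt1) t12 D.
have : 0 <= (t1 - 8) * (t2 - t1) by apply: mulr_ge0; lra.
lra.
Qed.

(** Between e/2 and 2 the drift is at most - (e/2) (t - 2). Half of its leading term cancels the
    noise, and the threshold 4 + 4/e makes the rest exceed the unit loss that the barrier asks
    for. *)
Lemma upper_limit T e : s <= T -> (forall u, T <= u -> x u < 2) -> 0 < e ->
  exists2 T', T <= T' & forall u, T' <= u -> x u < e.
Proof.
move=> sT x2 e0; wlog e1 : e e0 / e <= 1.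
  move=> H; have [e1|e1] := lerP e 1; first exact: H.
  have [T' TT' H'] := H 1 ltac:(lra) (lexx _); exists T' => // u uT.
  by have := H' u uT; lra.
have [T0 [T00 H0]] := tv (e := e / 4) ltac:(lra).
pose T1 := Num.max T (Num.max T0 (4 + 4 / e)).
have : T1 <= T1 by [].
rewrite {1}/T1 !ge_max => /andP[T1T /andP[T1T0 T1e]].
have ie : 4 / e * e = 4 by rewrite mulfVK// gt_eqF.
have ie0 : 4 <= 4 / e by rewrite ler_pdivlMr//; lra.
have [T' TT' H'] : exists2 T', T1 <= T' & forall u, T' <= u -> x u < e.
  apply: (@barrier_trap _ x T1 (e / 2) e (e / 4)); [|lra|lra|lra|].
    by apply: cont_fromW cx; lra.
  move=> t1 t2 Tt1 t12 t21 B.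
  have D r : t1 <= r -> r <= t2 -> drift r <= - (e / 2 * (t1 - 2)).
    move=> tr rt; have b1 := B r tr rt; have b2 := x2 r ltac:(lra).
    have : e / 2 * (t1 - 2) <= x r * (r - x r) by rewrite ler_pM//; lra.
    rewrite /drift; lra.
  have := H0 t1 t2 ltac:(lra) t12 ltac:(lra); rewrite ler_norml => /andP[_].
  have st1 : s <= t1 by lra.
  have := up st1 t12 D.
  have k1 : 1 <= e / 4 * t1 - e.
    have : e * (4 + 4/e) <= e * t1 by rewrite ler_wpM2l//; lra.
    rewrite mulrDr; lra.
  have : 0 <= (e / 4 * t1 - e - 1) * (t2 - t1) by apply: mulr_ge0; lra.
  lra.
exists T' => //; lra.
Qed.

(** The same barrier for - x: below - e/2 the drift is at least (e/2) u, however negative x is. *)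
Lemma lower_limit e : 0 < e -> exists T', forall u, T' <= u -> - e < x u.
Proof.
wlog e1 : e / e <= 1.
  move=> H e0; have [e1|e1] := lerP e 1; first exact: H.
  have [T' H'] := H 1 (lexx _) ltac:(lra); exists T' => u uT.
  by have := H' u uT; lra.
move=> e0; have [T0 [T00 H0]] := tv (e := e / 4) ltac:(lra).
pose T1 := Num.max s (Num.max T0 (4 + 4 / e)).
have : T1 <= T1 by [].
rewrite {1}/T1 !ge_max => /andP[T1T /andP[T1T0 T1e]].
have ie : 4 / e * e = 4 by rewrite mulfVK// gt_eqF.
have ie0 : 4 <= 4 / e by rewrite ler_pdivlMr//; lra.
have [T' TT' H'] : exists2 T', T1 <= T' & forall u, T' <= u -> - x u < e.
  apply: (@barrier_trap _ (fun u => - x u) T1 (e / 2) e (e / 4)); [|lra|lra|lra|].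
    by apply/cont_fromN; apply: cont_fromW cx; lra.
  move=> t1 t2 Tt1 t12 t21 B.
  have D r : t1 <= r -> r <= t2 -> e / 2 * t1 <= drift r.
    move=> tr rt; have b1 := B r tr rt.
    have : e / 2 * t1 <= (- x r) * (r - x r) by rewrite ler_pM//; lra.
    rewrite /drift; lra.
  have := H0 t1 t2 ltac:(lra) t12 ltac:(lra); rewrite ler_norml => /andP[+ _].
  have st1 : s <= t1 by lra.
  have := lo st1 t12 D.
  have k1 : 1 <= e / 4 * t1.
    have : e * (4 + 4/e) <= e * t1 by rewrite ler_wpM2l//; lra.
    rewrite mulrDr; lra.
  have : 0 <= (e / 4 * t1 - 1) * (t2 - t1) by apply: mulr_ge0; lra.
  lra.
exists T' => u /H'; lra.
Qed.

Lemma tends_to_0_or_near_diagonal :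
  (forall e, 0 < e -> exists T, forall u, T <= u -> `|x u| < e) \/
  (exists T, forall u, T <= u -> `|x u - u| <= 1).
Proof.
have [Ta Ha] := above_diagonal_absurd.
have [Tb Hb] := below_diagonal_hits1.
have [Tc Hc] := hits1_stays2.
pose T0 := Num.max s (Num.max Ta (Num.max Tb Tc)).
have [[T TT xT]|N] := pselect (exists2 T, T0 <= T & x T < T - 1); [left|right].
  move: TT; rewrite /T0 !ge_max => /andP[sT /andP[TaT /andP[TbT TcT]]].
  have [u Tu xu] := Hb T TbT xT.
  have su := Hc u (le_trans TcT Tu) xu.
  move=> e e0; have [T1 uT1 H1] := upper_limit (le_trans sT Tu) su e0.
  have [T2 H2] := lower_limit e0.
  exists (Num.max T1 T2) => r; rewrite ge_max => /andP[/H1 + /H2].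
  by rewrite ltr_norml => -> ->.
exists T0 => u T0u; rewrite ler_norml; apply/andP; split.
  rewrite leNgt; apply/negP => xu; apply: N; exists u => //; lra.
move: T0u; rewrite /T0 !ge_max => /andP[sT /andP[TaT _]].
by have := Ha u TaT; lra.
Qed.
End dichotomy.

(** * The Euler scheme *)

Section compactness.
Context {R : realType}.
Implicit Types (f g : R -> R) (s T : R).

Lemma cont_from_clamp s g : cont_from s g -> continuous (fun u => g (Num.max s u)).
Proof.
move=> cg u; apply/cvgrPdist_lt => e e0.
have [|d d0 H] := cg (Num.max s u) _ e e0; first by rewrite le_max lexx.
near=> t; rewrite distrC; apply: H; first by rewrite le_max lexx.
have td : `|u - t| < d by near: t; exact: cvgr_dist_lt.
rewrite (le_lt_trans _ td)// distrC; move: td => _.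
rewrite /Num.max; case: ltP => A; case: ltP => B; case: (lerP t u) => C;
  rewrite ?(ler0_norm (x := t - u)) ?(gtr0_norm (x := t - u)) ?subr_le0 ?subr_gt0//;
  rewrite ler_norml; lra.
Unshelve. all: by end_near. Qed.

Lemma continuous_unif f a b e : continuous f -> 0 < e ->
  exists2 d, 0 < d & forall t u, a <= t -> t <= b -> `|u - t| < d -> `|f u - f t| < e.
Proof.
move=> cf e0.
have /compact_near_coveringP/(_ R (0 :
  R)^'+ (fun d t => forall u, `|u - t| < d -> `|f u - f t| < e) _) :=
  @segment_compact R a b.
move=> [].
  move=> x _.
  have e20 : 0 < e / 2 by lra.
  have /cvgrPdist_lt/(_ _ e20) := cf x.
  move=> /nbhs_ballP[d /= d0 H].
  exists (ball x (d / 2), [set r | r < d / 2]) => /=.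
    split; first by apply: nbhsx_ballx; lra.
    apply: nbhs_right_lt; lra.
  move=> [t r] /= [xt rd] u ut; move: xt; rewrite /ball/= => xt.
  have h1 : `|f x - f t| < e / 2 by apply: H; rewrite /ball/=; lra.
  have h2 : `|f x - f u| < e / 2.
    apply: H; rewrite /ball/=.
    have -> : x - u = (x - t) - (u - t) by ring.
    by rewrite (le_lt_trans (ler_normB _ _))//; lra.
  have -> : f u - f t = (f x - f t) - (f x - f u) by ring.
  by rewrite (le_lt_trans (ler_normB _ _))//; lra.
move=> d /= d0 H.
exists (d / 2); first lra.
move=> t u at_ tb; apply: (H (d / 2)) => //=; last by rewrite in_itv/= at_.
  by rewrite sub0r normrN gtr0_norm; lra.
lra.
Qed.

End compactness.

Section euler.
Context {R : realType}.
Variables (s x0 sigma : R).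

Definition grid (n k : nat) : R := s + k%:R / 2 ^+ n.

Fixpoint euler (p : R -> R) (n k : nat) : R :=
  if k is k'.+1 then
    euler p n k' + euler p n k' * (euler p n k' - grid n k') / 2 ^+ n
    + sigma * (p (grid n k) - p (grid n k'))
  else x0.

(* Only the values of [p] on dyadic grids enter, which makes this a measurable
   property of the increments of [p], with no regularity required. *)
Definition trapped (p : R -> R) := exists B : nat, forall T : nat,
  exists N : nat, forall n, (N <= n)%N -> forall k, (k <= T * 2 ^ n)%N ->
  `|euler p n k - grid n k| <= B%:R.

Lemma grid_ge n k : s <= grid n k.
Proof. by rewrite /grid lerDl divr_ge0// exprn_ge0. Qed.

Lemma gridS n k : grid n k.+1 = grid n k + (2 ^+ n)^-1.
Proof. by rewrite /grid -natr1 mulrDl mul1r addrA. Qed.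

Lemma natr2X n : (2 ^ n)%:R = 2 ^+ n :> R.
Proof. by rewrite natrX. Qed.

Lemma mesh_gt0 n : 0 < (2 ^+ n : R)^-1.
Proof. by rewrite invr_gt0 exprn_gt0. Qed.

Lemma mesh_le n k T : (k <= T * 2 ^ n)%N -> k%:R * (2 ^+ n : R)^-1 <= T%:R.
Proof.
move=> kT; rewrite ler_pdivrMr ?exprn_gt0//.
by rewrite -natr2X -natrM ler_nat.
Qed.

Lemma mesh_small d : 0 < d -> exists N, forall n, (N <= n)%N -> (2 ^+ n : R)^-1 < d.
Proof.
move=> d0; exists (Num.bound d^-1) => n Nn.
rewrite invf_plt ?posrE ?exprn_gt0//.
have /lt_le_trans := archi_boundP (ltW (eqbRL (invr_gt0 d) d0)); apply.
rewrite -natr2X ler_nat (leq_trans Nn)//; exact/ltnW/ltn_expl.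
Qed.

(** Discrete Gronwall estimate. The drift is only locally Lipschitz, so the induction also uses that
    the error so far is at most 1. The scheme then stays close to [x], which is within B of the
    diagonal, and a step multiplies the error by at most 1 + h L. *)
Lemma euler_trapped (x w : R -> R) : solves s x (fun u => sigma * w u) -> x s = x0 ->
  (exists T, forall u, T <= u -> `|x u - u| <= 1) -> trapped w.
Proof.
move=> [cx [lo up]] xs [Tx HT].
have cm : continuous (fun u => Num.max s u).
  have := cont_from_clamp (@cont_from_affine _ s 1 0).
  by under eq_fun do rewrite mul1r addr0.
have cc := cont_from_clamp cx.
have [B B1 HB] : exists2 B : R, 1 <= B & forall u, s <= u -> `|x u - u| <= B.
  have c1 : continuous (fun u => `|x (Num.max s u) - Num.max s u|).
    by move=> u; apply: cvg_norm; apply: (@cvgB _ R^o); [exact: cc|exact: cm].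
  have [c _ Hc] := @EVT_max R (fun u =>
    `|x (Num.max s u) - Num.max s u|) s (Num.max s Tx) ltac:(by rewrite le_max lexx)
      (continuous_subspaceT c1).
  exists (Num.max 1 `|x (Num.max s c) - Num.max s c|); first by rewrite le_max lexx.
  move=> u su; rewrite le_max; have [uT|/ltW/HT ->//] := lerP u Tx.
  apply/orP; right; have := Hc u; rewrite /= in_itv/= su le_max uT orbT (max_idPr su);
    exact.
exists (Num.bound (B + 1)) => T.
have Bb : B + 1 < (Num.bound (B + 1))%:R by apply: archi_boundP; lra.
(* From y (y - t) - x (x - t) = (y - x) ((y - x) + 2 (x - t) + t) with |y - x| <= 1, |x - t| <= B
   and |t| <= |s| + T. *)
pose L := 1 + 2 * B + `|s| + T%:R.
have L0 : 0 <= L by rewrite /L; have := normr_ge0 s; have := ler0n R T; lra.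
(* Admissible consistency error per unit of time: accumulated over T units and amplified by exp(L T)
   it stays below 1. Using T + 1 avoids a zero denominator at T = 0. *)
pose om := ((T%:R + 1) * expR (L * T%:R))^-1.
have om0 : 0 < om by rewrite invr_gt0 mulr_gt0// ?expR_gt0// ltr_wpDl.
have cf : continuous (fun u => drift x (Num.max s u)).
  move=> u; apply: (@cvgM _ R^o); first exact: cc.
  by apply: (@cvgB _ R^o); [exact: cc|exact: cm].
have [d d0 Hd] := @continuous_unif R _ s (s + T%:R) om cf om0.
have [N HN] := mesh_small d0.
exists N => n Nn; set h := (2 ^+ n : R)^-1.
have h0 : 0 < h := mesh_gt0 n.
have hd : h < d := HN n Nn.
pose q := 1 + h * L.
have q1 : 1 <= q by rewrite /q lerDl mulr_ge0// ltW.
have cons k : (k < T * 2 ^ n)%N ->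
    `|x (grid n k.+1) - x (grid n k) - sigma * (w (grid n k.+1) - w (grid n k))
      - drift x (grid n k) * h| <= om * h.
  move=> kT; have gk : grid n k <= s + T%:R by rewrite lerD2l mesh_le// ltnW.
  have gS := gridS n k; rewrite -/h in gS.
  have D u : grid n k <= u -> u <= grid n k.+1 ->
      `|drift x u - drift x (grid n k)| < om.
    move=> ku uk; have := Hd (grid n k) u (grid_ge n k) gk.
    rewrite (max_idPr (grid_ge n k)) (max_idPr _) ?(le_trans (grid_ge n k))//.
    by apply; rewrite ger0_norm; lra.
  have l : grid n k <= grid n k.+1 by lra.
  have := @up (grid n k) (grid n k.+1) (drift x (grid n k) + om) (grid_ge n k) l.
  move=> /(_ ltac:(by move=> u ku uk; have := D u ku uk; rewrite ltr_norml => /andP[];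
    lra)).
  have := @lo (grid n k) (grid n k.+1) (drift x (grid n k) - om) (grid_ge n k) l.
  move=> /(_ ltac:(by move=> u ku uk; have := D u ku uk; rewrite ltr_norml => /andP[];
    lra)).
  have -> : grid n k.+1 - grid n k = h by lra.
  by rewrite ler_norml; lra.
have err k : (k <= T * 2 ^ n)%N -> om * (k%:R * h) * q ^+ k <= 1.
  move=> kT; have kh := mesh_le kT; rewrite -/h in kh.
  have kh0 : 0 <= k%:R * h by rewrite mulr_ge0// ltW.
  have qk : q ^+ k <= expR (L * T%:R).
    apply: (@le_trans _ _ (expR (h * L) ^+ k)).
      by rewrite lerXn2r ?nnegrE ?expR_ge0//; [lra|exact: expR_ge1Dx].
    rewrite -expRM_natl ler_expR mulrA mulrC ler_wpM2l//.
  rewrite -mulrA /om mulrC ler_pdivrMr ?mul1r;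
    last by rewrite mulr_gt0// ?expR_gt0// ltr_wpDl.
  by rewrite ler_pM// ?exprn_ge0//; lra.
have E k : (k <= T * 2 ^ n)%N ->
    `|euler w n k - x (grid n k)| <= om * (k%:R * h) * q ^+ k.
  elim: k => [_|k IH kT].
    by rewrite /= /grid mulr0n !mul0r addr0 xs subrr normr0 mulr0 mul0r.
  have {}IH := IH (ltnW kT).
  have e1 := le_trans IH (err _ (ltnW kT)).
  have c := cons k kT.
  have b := HB _ (grid_ge n k).
  rewrite /=; set ek := euler w n k in IH e1 *; set xk := x (grid n k) in IH e1 c b *.
  have gk : `|grid n k| <= `|s| + T%:R.
    rewrite (le_trans (ler_normD _ _))// lerD2l ger0_norm ?divr_ge0 ?exprn_ge0//.
    exact/mesh_le/ltnW.
  have -> : ek + ek * (ek - grid n k) / 2 ^+ n +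
    sigma * (w (grid n k.+1) - w (grid n k)) - x (grid n k.+1) =
    (ek - xk) * (1 + h * ((ek - xk) + 2 * (xk - grid n k) + grid n k))
    - (x (grid n k.+1) - xk - sigma * (w (grid n k.+1) - w (grid n k)) -
      drift x (grid n k) * h).
    by rewrite /drift -/xk -/h; ring.
  rewrite (le_trans (ler_normB _ _))//.
  have f : `|1 + h * ((ek - xk) + 2 * (xk - grid n k) + grid n k)| <= q.
    rewrite (le_trans (ler_normD _ _))// normr1 lerD2l normrM gtr0_norm//.
    rewrite ler_pM2l// /L.
    have n2 : `|2 * (xk - grid n k)| <= 2 * B by rewrite normrM ger0_norm// ler_wpM2l.
    have := ler_normD (ek - xk + 2 * (xk - grid n k)) (grid n k).
    have := ler_normD (ek - xk) (2 * (xk - grid n k)).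
    lra.
  have m : `|ek - xk| * `|1 + h * ((ek - xk) + 2 * (xk - grid n k) + grid n k)| <=
     om * (k%:R * h) * q ^+ k * q by rewrite ler_pM.
  have Q : 1 <= q ^+ k.+1 by rewrite exprn_ege1.
  have oq : om * h * 1 <= om * h * q ^+ k.+1 by rewrite ler_pM2l// mulr_gt0.
  rewrite normrM; move: m oq; rewrite exprSr -(natr1 k); lra.
move=> k kT; have := E k kT; have := err k kT; have := HB _ (grid_ge n k).
have -> : euler w n k - grid n k = (euler w n k - x (grid n k)) +
  (x (grid n k) - grid n k) by ring.
move=> h1 h2 h3; rewrite (le_trans (ler_normD _ _))//; lra.
Qed.

(** The Cameron-Martin direction. It is constant after s + 1, so the density of the shift involves
    only the increment W (s + 1) - W s. *)
Definition ramp (u : R) : R := Num.min (u - s) 1.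

Lemma ramp_grid n k : (k <= 2 ^ n)%N -> ramp (grid n k) = k%:R / 2 ^+ n.
Proof.
move=> kn; rewrite /ramp /grid addrAC subrr add0r; apply/min_idPl.
by rewrite ler_pdivrMr ?exprn_gt0// mul1r -natr2X ler_nat.
Qed.

Lemma ramp_grid1 n k : (2 ^ n <= k)%N -> ramp (grid n k) = 1.
Proof.
move=> kn; rewrite /ramp /grid addrAC subrr add0r; apply/min_idPr.
by rewrite ler_pdivlMr ?exprn_gt0// mul1r -natr2X ler_nat.
Qed.

Definition shifted (p : R -> R) (c u : R) := p u + c * ramp u.

Lemma shifted_gridS p c n k : shifted p c (grid n k.+1) - shifted p c (grid n k) =
  p (grid n k.+1) - p (grid n k) + c * ((k < 2 ^ n)%N%:R / 2 ^+ n).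
Proof.
rewrite /shifted; case: ltnP => kn.
  by rewrite !ramp_grid// ?(ltnW kn)// -(natr1 k) /= mulr1n; ring.
by rewrite !ramp_grid1// ?(leqW kn)//= mulr0n; ring.
Qed.

(* The gap between the two schemes is created during the ramp and is then
   multiplied at the rate [E1 + E2 - t >= t - 2 B], which is positive for large
   [t], so it cannot stay bounded. *)
Lemma trapped_shifted_disjoint p c1 c2 : 0 <= s -> 0 < sigma -> c1 < c2 ->
  trapped (shifted p c1) -> trapped (shifted p c2) -> False.
Proof.
move=> s0 sg c12 [B1 H1] [B2 H2].
pose b := maxn B1 B2.
(* Both schemes lie within [b] of the diagonal, so [a] bounds their gap, and t - a bounds the growth
   rate E1 + E2 - t from below. *)
pose a : R := 2 * b%:R.
have a0 : 0 <= a by rewrite mulr_ge0.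
pose kp := sigma * (c2 - c1).
have kp0 : 0 < kp by rewrite mulr_gt0// subr_gt0.
(* From time T1 = a + 1 on, the growth rate is at least 1. *)
pose T1 := (2 * b).+1.
have T1a : T1%:R = a + 1 by rewrite -natr1 natrM.
(* What survives of the gap [kp] after T1 units of time at the worst rate - a. The factor 2 comes
   from 1 - a h >= exp(- 2 a h), valid for a h <= 1/2. *)
pose d0 := kp * expR (- (2 * a * T1%:R)).
have d00 : 0 < d0 by rewrite mulr_gt0 ?expR_gt0.
(* At rate 1 a gap of at least [d0] gains [d0] per unit of time, so J units push it beyond [a]. *)
pose J := Num.bound (a / d0).
have Jd : a < J%:R * d0.
  by rewrite -ltr_pdivrMr// archi_boundP// divr_ge0// ltW.
have [N1 {}H1] := H1 (T1 + J)%N; have [N2 {}H2] := H2 (T1 + J)%N.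
have [N3 H3] := @mesh_small (1 / (2 * a + 1)) ltac:(by rewrite divr_gt0//; lra).
pose n := maxn N1 (maxn N2 N3).
have /H1{}H1 : (N1 <= n)%N by rewrite leq_maxl.
have /H2{}H2 : (N2 <= n)%N by rewrite !leq_max leqnn orbT.
have /H3{}H3 : (N3 <= n)%N by rewrite !leq_max leqnn !orbT.
have h0 := mesh_gt0 n.
set h := (2 ^+ n : R)^-1 in H3 h0.
have ah : a * h <= 1 / 2.
  by move: H3; rewrite ltr_pdivlMr; lra.
pose E1 := euler (shifted p c1) n; pose E2 := euler (shifted p c2) n.
pose D k := E2 k - E1 k.
have g1 k : (k <= (T1 + J) * 2 ^ n)%N -> `|E1 k - grid n k| <= b%:R.
  by move=> /H1 /le_trans; apply; rewrite ler_nat leq_maxl.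
have g2 k : (k <= (T1 + J) * 2 ^ n)%N -> `|E2 k - grid n k| <= b%:R.
  by move=> /H2 /le_trans; apply; rewrite ler_nat leq_maxr.
have Da k : (k <= (T1 + J) * 2 ^ n)%N -> D k <= a.
  move=> kT; have := g1 k kT; have := g2 k kT; rewrite !ler_norml /D /a; lra.
have DS k : D k.+1 = D k * (1 + h * (E1 k + E2 k - grid n k)) + kp * ((k < 2 ^ n)%N%:R * h).
  rewrite /D /E1 /E2 [euler _ _ k.+1]/= [euler (shifted p c1) _ k.+1]/= !shifted_gridS
    -/h /kp.
  by ring.
have low k : (k <= (T1 + J) * 2 ^ n)%N -> grid n k - a <= E1 k + E2 k - grid n k.
  move=> kT; have := g1 k kT; have := g2 k kT; rewrite !ler_norml /a; lra.
have q0 : 0 < 1 - a * h by lra.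
have q1 : 1 - a * h <= 1 by have := mulr_ge0 a0 (ltW h0); lra.
have grow k : (k <= (T1 + J) * 2 ^ n)%N -> 0 <= D k ->
    D k * (1 - a * h) + kp * ((k < 2 ^ n)%N%:R * h) <= D k.+1.
  move=> kT Dk; rewrite DS lerD2r ler_wpM2l//.
  have := low k kT; have := grid_ge n k => sg' l.
  have : h * (- a) <= h * (E1 k + E2 k - grid n k) by rewrite ler_wpM2l//; lra.
  lra.
(* During the ramp each step adds kp h, and what was added before loses at most a factor 1 - a h. *)
have P1 k : (k <= 2 ^ n)%N -> kp * (k%:R * h) * (1 - a * h) ^+ k <= D k.
  elim: k => [_|k IH kn]; first by rewrite /D /E1 /E2 /= subrr mulr0n mul0r mulr0 mul0r.
  have {}IH := IH (ltnW kn).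
  have Dk0 : 0 <= D k.
    apply: le_trans IH; apply: mulr_ge0; last by rewrite exprn_ge0// ltW.
    exact: mulr_ge0 (ltW kp0) (mulr_ge0 (ler0n _ _) (ltW h0)).
  have kT : (k <= (T1 + J) * 2 ^ n)%N.
    by rewrite (leq_trans (ltnW kn))// leq_pmull// addSn.
  have := grow k kT Dk0; rewrite kn mul1r; apply: le_trans.
  have := ler_wpM2r (ltW q0) IH.
  have Q : (1 - a * h) ^+ k.+1 <= 1 by rewrite exprn_ile1// ltW.
  have := ler_wpM2l (ltW (mulr_gt0 kp0 h0)) Q.
  rewrite exprSr -(natr1 k); lra.
have P2 k : (2 ^ n <= k)%N -> (k <= T1 * 2 ^ n)%N -> kp * (1 - a * h) ^+ k <= D k.
  elim: k => [|k IH].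
    by rewrite leqn0 expn_eq0.
  rewrite leq_eqVlt => /predU1P[<- _|].
    have := P1 _ (leqnn _); rewrite natr2X mulfV ?mulr1//; apply: lt0r_neq0;
      exact: exprn_gt0.
  rewrite ltnS => nk kT; have {}IH := IH nk (ltnW kT).
  have Dk0 : 0 <= D k.
    by apply: le_trans IH; rewrite mulr_ge0// ?exprn_ge0// ltW.
  have kT' : (k <= (T1 + J) * 2 ^ n)%N.
    by rewrite (leq_trans (ltnW kT))// leq_mul2r leq_addr orbT.
  have := grow k kT' Dk0; rewrite ltnNge nk/= mul0r mulr0 addr0; apply: le_trans.
  by rewrite exprSr mulrA ler_wpM2r// ltW.
have P3 : d0 <= D (T1 * 2 ^ n)%N.
  apply: le_trans (P2 _ _ (leqnn _)); last by rewrite leq_pmull.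
  rewrite /d0 ler_pM2l//.
  have -> : - (2 * a * T1%:R) = (T1 * 2 ^ n)%:R * (- (2 * (a * h))).
    by rewrite natrM natr2X /h; field; rewrite lt0r_neq0// exprn_gt0.
  rewrite expRM_natl; apply: lerXn2r; [exact: expR_ge0|exact: ltW|].
  rewrite expRN -[leRHS]invrK lef_pV2 ?posrE ?expR_gt0 ?invr_gt0//.
  apply: (@le_trans _ _ (1 + 2 * (a * h))); last exact: expR_ge1Dx.
  rewrite -[leLHS]mul1r ler_pdivrMr//.
  have ah0 := mulr_ge0 a0 (ltW h0).
  have : 0 <= (a * h) * (1 - 2 * (a * h)) by rewrite mulr_ge0//; lra.
  lra.
have P4 j : (j <= J * 2 ^ n)%N -> d0 + d0 * (j%:R * h) <= D (T1 * 2 ^ n + j)%N.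
  elim: j => [_|j IH jJ]; first by rewrite mulr0n mul0r mulr0 addr0 addn0.
  have {}IH := IH (ltnW jJ).
  have jh : 0 <= d0 * (j%:R * h) := mulr_ge0 (ltW d00) (mulr_ge0 (ler0n _ _) (ltW h0)).
  rewrite addnS DS.
  have kT : (T1 * 2 ^ n + j <= (T1 + J) * 2 ^ n)%N.
    by rewrite mulnDl leq_add2l ltnW.
  rewrite ltnNge (leq_trans (leq_pmull (2 ^ n) (ltn0Sn _)) (leq_addr _ _))/= mul0r
    mulr0 addr0.
  have := low _ kT.
  have : T1%:R <= grid n (T1 * 2 ^ n + j).
    rewrite /grid natrD mulrDl natrM natr2X mulfK ?lt0r_neq0 ?exprn_gt0//.
    have : 0 <= j%:R / 2 ^+ n :> R by rewrite divr_ge0// exprn_ge0.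
    lra.
  rewrite T1a => G L.
  have F : h * 1 <= h * (E1 (T1 * 2 ^ n + j)%N + E2 (T1 * 2 ^ n +
    j)%N - grid n (T1 * 2 ^ n + j)).
    by rewrite ler_pM2l//; lra.
  have : D (T1 * 2 ^ n + j)%N * (1 + h) <=
    D (T1 * 2 ^ n + j)%N * (1 + h * (E1 (T1 * 2 ^ n + j)%N + E2 (T1 * 2 ^ n +
      j)%N - grid n (T1 * 2 ^ n + j))).
    by rewrite ler_wpM2l//; lra.
  apply: le_trans.
  have : d0 * h <= D (T1 * 2 ^ n + j)%N * h by rewrite ler_pM2r//; lra.
  rewrite -(natr1 j); lra.
have := P4 _ (leqnn _); rewrite -mulnDl; have := Da _ (leqnn _).
rewrite natrM natr2X /h mulfK ?lt0r_neq0 ?exprn_gt0//; lra.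
Qed.
End euler.

(** * Gaussian estimates and the regularity of Brownian paths *)

Section gaussian.
Context {R : realType}.
Implicit Types (m s a x : R).
Local Notation mu := (@lebesgue_measure R).

Lemma normal_pdf_tilt m s x : s != 0 ->
  normal_pdf m s x = expR (m * x / s ^+ 2 - m ^+ 2 / (2 * s ^+ 2)) * normal_pdf 0 s x.
Proof.
move=> s0; rewrite !normal_pdfE// /normal_fun mulrCA -expRD; congr (_ * expR _).
by rewrite -mulr_natl; field.
Qed.

(* Doubling the variance trades half of the exponent for a Gaussian tail bound. *)
Lemma normal_pdf_le_wide s a x : s != 0 -> 0 <= a -> a <= `|x| ->
  normal_pdf 0 s x <=
    2 * expR (- (a ^+ 2 / (4 * s ^+ 2))) * normal_pdf 0 (s * Num.sqrt 2) x.
Proof.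
move=> s0 a0 ax; set c := expR _; set t := s * _.
have t0 : t != 0 by rewrite mulf_neq0// gt_eqF// sqrtr_gt0.
have t2 : t ^+ 2 = 2 * s ^+ 2 by rewrite exprMn sqr_sqrtr// mulrC.
rewrite !normal_pdfE// /normal_fun t2 subr0.
have -> : normal_peak t = normal_peak s / Num.sqrt 2.
  have p0 : 0 <= s ^+ 2 * pi *+ 2 by rewrite mulrn_wge0// mulr_ge0 ?sqr_ge0// pi_ge0.
  rewrite /normal_peak t2 -[RHS]invfM -sqrtrM//.
  by congr (Num.sqrt _)^-1; ring.
have -> : - x ^+ 2 / (s ^+ 2 *+ 2) = - x ^+ 2 / ((2 * s ^+ 2) *+ 2) +
  - (x ^+ 2 / (4 * s ^+ 2)).
  by rewrite -[(2 * s ^+ 2) *+ 2]mulr_natl -[s ^+ 2 *+ 2]mulr_natl; field.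
rewrite expRD.
have : expR (- (x ^+ 2 / (4 * s ^+ 2))) <= c.
  have q0 : 0 < 4 * s ^+ 2 by rewrite pmulr_rgt0// exprn_even_gt0.
  rewrite ler_expR lerN2 ler_pM2r ?invr_gt0//.
  by rewrite -(real_normK (num_real x)) lerXn2r.
set e := expR (- x ^+ 2 / _); set e2 := expR (- _) => e2c.
have e0 : 0 <= e by rewrite expR_ge0.
have p0 : 0 <= normal_peak s := normal_peak_ge0 s.
have r : 1 <= 2 / Num.sqrt 2 :> R.
  rewrite ler_pdivlMr ?sqrtr_gt0// mul1r.
  have -> : (2 : R) = Num.sqrt (2 ^+ 2) by rewrite sqrtr_sqr gtr0_norm.
  by rewrite ler_sqrt ?sqrtr_sqr ?gtr0_norm ?exprn_ge0//; lra.
have -> : 2 * c * (normal_peak s / Num.sqrt 2 * e) =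
  (normal_peak s * e) * (2 / Num.sqrt 2 * c) by ring.
rewrite [leLHS]mulrA; apply: ler_wpM2l; first exact: mulr_ge0.
by rewrite (le_trans e2c)// ler_peMl// expR_ge0.
Qed.

Lemma measurable_norm_gt a : measurable [set x : R | a < `|x|].
Proof.
rewrite [X in measurable X](_ : _ = setT `&` (fun x : R => `|x|) @^-1` `]a, +oo[).
  exact: normr_measurable.
by rewrite setTI; apply/seteqP; split => x /=; rewrite in_itv/= andbT.
Qed.

Lemma normal_tail s a : s != 0 -> 0 <= a ->
  (normal_prob 0 s [set x : R | (a < `|x|)%R] <=
    (2 * expR (- (a ^+ 2 / (4 * s ^+ 2))))%:E)%E.
Proof.
move=> s0 a0; set c := expR _.
have mA := measurable_norm_gt a.
rewrite /normal_prob.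
apply: (@le_trans _ _ (\int[mu]_(x in [set x :
  R | (a < `|x|)%R]) ((2 * c)%:E * (normal_pdf 0 (s * Num.sqrt 2) x)%:E))%E).
  apply: ge0_le_integral => //=.
  - by move=> x _; rewrite lee_fin normal_pdf_ge0.
  - by apply/measurable_EFinP; apply: measurable_funTS; exact: measurable_normal_pdf.
  - by apply/measurable_EFinP/measurable_funM => //; apply: measurable_funTS;
    exact: measurable_normal_pdf.
  by move=> x ax; rewrite -EFinM lee_fin normal_pdf_le_wide// ltW.
rewrite ge0_integralZl//=; last 3 first.
- by apply/measurable_EFinP; apply: measurable_funTS; exact: measurable_normal_pdf.
- by move=> x _; rewrite lee_fin normal_pdf_ge0.
- by rewrite lee_fin mulr_ge0 ?expR_ge0.
rewrite -[leRHS]mule1 lee_wpmul2l ?lee_fin ?mulr_ge0 ?expR_ge0//.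
by rewrite -/(normal_prob 0 (s * Num.sqrt 2) _) probability_le1.
Qed.

Definition translate m x : measurableTypeR R := x + m.

Lemma measurable_translate m : measurable_fun setT (translate m).
Proof. exact: measurable_funD. Qed.

(** Uniqueness of Lebesgue measure reduces invariance to half-open intervals. *)
Lemma lebesgue_measure_translate m (A : set R) : measurable A ->
  pushforward mu (translate m) A = mu A.
Proof.
move=> mA; apply/esym/lebesgue_measure_unique  => //=; first exact: measurable_translate.
move=> _ _ [[a b]] _ <-.
rewrite /pushforward.
have -> : translate m @^-1` `]a, b] = `]a - m, b - m]%classic.
  by apply/seteqP; split => x /=; rewrite /translate !in_itv/= ltrBlDr lerBrDr.
rewrite !lebesgue_measure_itv/= !lte_fin ltrD2r; case: ifP => // _.
by rewrite -!EFinB; congr EFin; ring.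
Qed.

Lemma normal_prob_translate m s (B : set R) : s != 0 -> measurable B ->
  normal_prob 0 s (translate m @^-1` B) = normal_prob m s B.
Proof.
move=> s0 mB; rewrite /normal_prob.
have mf : measurable_fun B (fun x : measurableTypeR R => (normal_pdf m s x)%:E).
  by apply/measurable_EFinP; apply: measurable_funTS; exact: measurable_normal_pdf.
have f0 : {in B, forall x : measurableTypeR R, (0 <= (normal_pdf m s x)%:E)%E}.
  by move=> x _; rewrite lee_fin normal_pdf_ge0.
transitivity (\int[pushforward mu (translate m)]_(x in B) (normal_pdf m s x)%:E)%E.
  have := @ge0_integral_pushforward _ _ (measurableTypeR R) (measurableTypeR R) R
    (translate m) (measurable_translate m) mu B _ mB mf f0.
  move=> ->; apply: eq_integral => x _ /=; rewrite !normal_pdfE// /normal_fun/=.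
  by rewrite /translate subr0 addrK.
apply: eq_measure_integral => //=; first exact: measurable_translate.
by move=> _ A mA AS; exact: lebesgue_measure_translate.
Qed.
End gaussian.

(** * Chaining over 16-adic grids *)

Section chaining.
Context {R : realType}.
Variable w : R -> R.

(* At level [j] the mesh [16^-j] has Gaussian scale [4^-j], much below [2^-j],
   and [512^j] steps cover [0, 32^j]; since [32 > 16] the mesh is eventually
   finer than [1/t] at times [t ~ 32^j]. *)
Definition increments_small := exists J : nat, forall j, (J <= j)%N ->
  forall k, (k < 512 ^ j)%N ->
  `|w (k.+1%:R / 16 ^+ j) - w (k%:R / 16 ^+ j)| <= 2^-1 ^+ j.

Hypothesis cw : cont_from 0 w.

Let cell (j : nat) (t : R) : nat := Num.truncn (t * 16 ^+ j).
Let pt (j : nat) (t : R) : R := (cell j t)%:R / 16 ^+ j.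

Let p16 j : 0 < (16 : R) ^+ j. Proof. by rewrite exprn_gt0. Qed.

Let cell_itv j t : 0 <= t -> (cell j t)%:R <= t * 16 ^+ j < (cell j t).+1%:R.
Proof. by move=> t0; apply: truncn_itv; rewrite mulr_ge0// exprn_ge0. Qed.

Let pt_le j t : 0 <= t -> pt j t <= t.
Proof. by move=> t0; have /andP[] := cell_itv j t0; rewrite ler_pdivrMr. Qed.

Let pt_close j t : 0 <= t -> t - pt j t < (16 ^+ j)^-1.
Proof.
move=> t0; have /andP[_] := cell_itv j t0.
by rewrite ltrBlDl /pt -[X in _ + X]mul1r -mulrDl natr1 ltr_pdivlMr.
Qed.

Let cell_lt_512 j t : 0 <= t -> t <= 32 ^+ j -> (cell j t <= 512 ^ j)%N.
Proof.
move=> t0 tj; rewrite -(ler_nat R); have /andP[+ _] := cell_itv j t0.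
move=> /le_trans; apply; rewrite natrX (_ : 512%:R = 32 * 16); last by rewrite -natrM.
by rewrite exprMn ler_pM2r.
Qed.

Lemma grid_osc j (a n : nat) : (forall k, (k < 512 ^ j)%N ->
    `|w (k.+1%:R / 16 ^+ j) - w (k%:R / 16 ^+ j)| <= 2^-1 ^+ j) ->
  (a + n <= 512 ^ j)%N ->
  `|w ((a + n)%:R / 16 ^+ j) - w (a%:R / 16 ^+ j)| <= n%:R * 2^-1 ^+ j.
Proof.
move=> H; elim: n => [|n IH] an; first by rewrite addn0 subrr normr0 mul0r.
have := H (a + n)%N; rewrite addnS in an * => /(_ an) h1.
have := IH (ltnW an) => h2.
rewrite -(natr1 n); have := ler_normD (w ((a + n).+1%:R / 16 ^+ j) - w ((a +
  n)%:R / 16 ^+ j))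
  (w ((a + n)%:R / 16 ^+ j) - w (a%:R / 16 ^+ j)).
rewrite addrA subrK; lra.
Qed.

(** The constant is 31 = 15 + 1 + 15. Passing from a time to its level j grid point costs at most 15
    cells on each finer level, a geometric sum closed by continuity; at most one cell separates the
    two grid points. *)
Lemma window_osc : increments_small -> exists J : nat, forall j, (J <= j)%N ->
  forall t u, 0 <= t -> t <= u -> u <= t + (16 ^+ j)^-1 -> u <= 32 ^+ j ->
  `|w u - w t| <= 31 * 2^-1 ^+ j.
Proof.
move=> [J H]; exists J => j Jj.
have step m t : (j <= m)%N -> 0 <= t -> t <= 32 ^+ j ->
    `|w (pt m.+1 t) - w (pt m t)| <= 15 * 2^-1 ^+ m.+1.
  move=> jm t0 tj.
  have tm : t <= 32 ^+ m.+1.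
    by rewrite (le_trans tj)// ler_weXn2l ?ler1n// (leq_trans jm).
  have /andP[a1 a2] := cell_itv m t0; have /andP[b1 b2] := cell_itv m.+1 t0.
  have lo : (16 * cell m t <= cell m.+1 t)%N.
    rewrite -ltnS -(ltr_nat R) (le_lt_trans _ b2)// exprSr natrM.
    by rewrite mulrA mulrC ler_pM2r.
  have hi : (cell m.+1 t <= 16 * cell m t + 15)%N.
    rewrite -ltnS -(ltr_nat R) (le_lt_trans b1)//.
    rewrite exprSr mulrA -addnS addnC -mulnS natrM [ltRHS]mulrC ltr_pM2r//.
  have -> : pt m t = (16 * cell m t)%:R / 16 ^+ m.+1.
    by rewrite /pt exprSr natrM; field; rewrite gt_eqF.
  rewrite /pt -{1}(subnKC lo).
  have := @grid_osc m.+1 (16 * cell m t) (cell m.+1 t - 16 * cell m t) _ _.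
  move=> /(_ (H _ (leq_trans Jj (leqW jm)))); rewrite subnKC// => /(_ (cell_lt_512 t0 tm)).
  move=> /le_trans; apply; rewrite ler_wpM2r ?exprn_ge0// ler_nat.
  by rewrite leq_subLR.
have chain m t : 0 <= t -> t <= 32 ^+ j ->
    `|w (pt (j + m) t) - w (pt j t)| <= 15 * (2^-1 ^+ j - 2^-1 ^+ (j + m)).
  move=> t0 tj; elim: m => [|m IH]; first by rewrite addn0 !subrr normr0 mulr0.
  have := step (j + m)%N t (leq_addr _ _) t0 tj; rewrite addnS.
  have := ler_normD (w (pt (j + m).+1 t) - w (pt (j + m) t)) (w (pt (j +
    m) t) - w (pt j t)).
  rewrite addrA subrK exprSr; lra.
have lim t : 0 <= t -> t <= 32 ^+ j -> `|w t - w (pt j t)| <= 15 * 2^-1 ^+ j.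
  move=> t0 tj; apply/ler_addgt0Pr => e e0.
  have [d d0 Hd] := cw t0 e0.
  have [m md] : exists m : nat, (16 ^+ (j + m) : R)^-1 < d.
    exists (Num.bound d^-1); rewrite invf_plt ?posrE//.
    have /lt_le_trans := archi_boundP (ltW (eqbRL (invr_gt0 d) d0)); apply.
    rewrite -natrX ler_nat (leq_trans (ltnW (ltn_expl _ (isT : (1 < 16)%N))))//.
    by rewrite leq_exp2l// leq_addl.
  have := Hd (pt (j + m) t); rewrite distrC.
  have pp : 0 <= pt (j + m) t by rewrite divr_ge0// exprn_ge0.
  have pl := pt_le (j + m) t0; have pc := pt_close (j + m) t0.
  rewrite ger0_norm ?subr_ge0// => /(_ pp (lt_trans pc md));
    rewrite (distrC (w (pt (j + m) t))).
  have := chain m t t0 tj.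
  have := ler_distD (w (pt (j + m) t)) (w t) (w (pt j t)).
  have : 0 < (2^-1 : R) ^+ (j + m) by rewrite exprn_gt0.
  lra.
move=> t u t0 tu utj u32.
have u0 : 0 <= u := le_trans t0 tu.
have := lim u u0 u32; have := lim t t0 (le_trans tu u32).
have /andP[a1 a2] := cell_itv j t0; have /andP[b1 b2] := cell_itv j u0.
have lo : (cell j t <= cell j u)%N.
  by rewrite -ltnS -(ltr_nat R) (le_lt_trans a1)// (le_lt_trans _ b2)// ler_pM2r.
have hi : (cell j u <= cell j t + 1)%N.
  rewrite -ltnS -(ltr_nat R) (le_lt_trans b1)//.
  have : u * 16 ^+ j <= (t + (16 ^+ j)^-1) * 16 ^+ j by rewrite ler_pM2r.
  rewrite mulrDl mulVf ?gt_eqF// addn1 -[(cell j t).+2%:R]natr1; lra.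
have : `|w (pt j u) - w (pt j t)| <= 1 * 2^-1 ^+ j.
  have := @grid_osc j (cell j t) (cell j u - cell j t) (H _ Jj).
  rewrite subnKC// => /(_ (cell_lt_512 u0 u32)) /le_trans; apply.
  by rewrite ler_wpM2r ?exprn_ge0// (ler_nat _ _ 1) leq_subLR.
have := ler_normD (w u - w (pt j u)) (w (pt j u) - w (pt j t)).
have := ler_normB (w u - w (pt j u) + (w (pt j u) - w (pt j t))) (w t - w (pt j t)).
have -> : w u - w (pt j u) + (w (pt j u) - w (pt j t)) - (w t - w (pt j t)) =
  w u - w t by ring.
lra.
Qed.

(** Choose 32^j <= 2 t < 32^(j+1) and use level j + 1. Its range covers the window, and its cells
    16^-(j+1) are at least 1/t long once 2^j >= 32, hence the 5 in [K]. The bound [M] makes 31 /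
    2^(j+1) at most [e]. *)
Lemma slow_window : increments_small -> forall e, 0 < e -> exists T0, 1 <= T0 /\
  forall t u, T0 <= t -> t <= u -> u <= t + t^-1 -> `|w u - w t| <= e.
Proof.
move=> /window_osc [J H] e e0.
have [M HM] := @mesh_small R (e / 31) ltac:(by rewrite divr_gt0).
pose K := maxn 5 (maxn J M).
exists (32 ^+ K); split; first by rewrite exprn_ege1// ler1n.
move=> t u Kt tu ut.
have t1 : 1 <= t by rewrite (le_trans _ Kt)// exprn_ege1// ler1n.
have [j [Kj jt tj]] : exists j, [/\ (K <= j)%N, 32 ^+ j <= 2 * t & 2 * t < 32 ^+ j.+1].
  have ex : exists j : nat, 2 * t < 32 ^+ j.
    exists (Num.bound (2 * t)).
    have /lt_le_trans := archi_boundP (ltac:(lra) : 0 <= 2 * t); apply.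
    by rewrite -natrX ler_nat ltnW// ltn_expl.
  case: (ex_minnP ex) => -[|j] tj mj; first by move: tj; rewrite expr0; lra.
  exists j; split => //.
    rewrite -ltnS -(@ltr_eXn2l R 32) ?ltr1n//.
    by rewrite (le_lt_trans Kt)// (lt_trans _ tj)//; lra.
  by rewrite leNgt; apply/negP => /mj; rewrite ltnn.
have it : t^-1 <= (16 ^+ j.+1)^-1.
  rewrite lef_pV2 ?posrE ?exprn_gt0//; last lra.
  have : (32 : R) <= 2 ^+ j.
    have -> : (32 : R) = 2 ^+ 5 by rewrite -natrX.
    by rewrite ler_weXn2l ?ler1n// (leq_trans _ Kj)// leq_maxl.
  have p : 0 < (16 : R) ^+ j by rewrite exprn_gt0.
  move=> h; have : 16 ^+ j * 32 <= 32 ^+ j :> R.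
    rewrite (_ : (32 : R) ^+ j = 16 ^+ j * 2 ^+ j) ?ler_pM2l//.
    by rewrite -exprMn; congr (_ ^+ _); ring.
  rewrite exprSr; lra.
apply: (@le_trans _ _ (31 * 2^-1 ^+ j.+1)).
  apply: H => //; [|lra|lra|].
    by rewrite (leq_trans _ (leqW Kj))// !leq_max leqnn orbT.
  have : t^-1 <= 1 by rewrite invf_le1//; lra.
  lra.
have Mj : (M <= j.+1)%N by rewrite (leq_trans _ (leqW Kj))// !leq_max leqnn !orbT.
by have := HM _ Mj; rewrite exprVn ltr_pdivlMr// mulrC => /ltW.
Qed.

(** Cut [t, u] into at most 2 t (u - t) + 1 equal windows of length at most 1 / (2 t). As u <= 2 t,
    each is short enough for [slow_window] at its own starting time, and each contributes e / 2
    after multiplication by [sigma]. *)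
Lemma tame_of_increments (sigma : R) : 0 < sigma -> increments_small ->
  tame (fun u => sigma * w u).
Proof.
move=> sg ws e e0.
have [T0 [T01 H]] := slow_window ws (divr_gt0 e0 (mulr_gt0 (ltr0n R 2) sg)).
set e' := e / (2 * sigma) in H.
exists T0; split; first lra.
move=> t u T0t tu ut.
pose y := 2 * (t * (u - t)).
have y0 : 0 <= y by rewrite !mulr_ge0//; lra.
pose n := (Num.truncn y).+1.
have n0 : 0 < n%:R :> R by rewrite ltr0n.
have yn : y < n%:R by apply: truncnS_gt.
have ny : n%:R <= y + 1.
  by have /andP[+ _] := truncn_itv y0; rewrite /n -natr1; lra.
pose d := (u - t) / n%:R.
have d0 : 0 <= d by rewrite divr_ge0//; lra.
have dt : 2 * t * d <= 1.
  by rewrite /d !mulrA ler_pdivrMr// mul1r ltW// -mulrA.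
have dn : d * n%:R = u - t by rewrite /d divfK// gt_eqF.
have P i : (i <= n)%N -> `|w (t + i%:R * d) - w t| <= i%:R * e'.
  elim: i => [_|i IH iN]; first by rewrite !mul0r addr0 subrr normr0.
  have {}IH := IH (ltnW iN).
  have id : i%:R * d <= u - t.
    by rewrite -dn mulrC ler_wpM2l// ler_nat ltnW.
  have i0 : 0 <= i%:R * d by rewrite mulr_ge0.
  have := H (t + i%:R * d) (t + i.+1%:R * d); rewrite -(natr1 i).
  have iv : d <= (t + i%:R * d)^-1.
    rewrite -[leRHS]mul1r ler_pdivlMr; last lra.
    rewrite (le_trans _ dt)// mulrC ler_wpM2r//; lra.
  move=> /(_ ltac:(lra) ltac:(lra) ltac:(lra)).
  have := ler_distD (w (t + i%:R * d)) (w (t + (i%:R + 1) * d)) (w t).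
  lra.
have := P n (leqnn _); rewrite mulrC dn subrKC -mulrBr normrM gtr0_norm// => h.
have : sigma * `|w u - w t| <= sigma * (n%:R * e') by rewrite ler_pM2l.
have -> : sigma * (n%:R * e') = n%:R * (e / 2) by rewrite /e'; field; rewrite gt_eqF.
have : n%:R * (e / 2) <= (y + 1) * (e / 2) by rewrite ler_wpM2r//; lra.
rewrite /y; have : 0 <= e / 2 by lra.
lra.
Qed.
End chaining.

(** * Almost sure smallness of the increments *)

Section brownian_increments.
Context d (T : measurableType d) (R : realType) (P : probability T R).
Variable W : R -> {RV P >-> R}.

Lemma measurable_increment s t (B : set R) : measurable B ->
  measurable [set w | B (W t w - W s w)].
Proof.
move=> mB; have mf : measurable_fun setT (fun w => W t w - W s w).
  by apply: measurable_funB; exact: measurable_funPT.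
by rewrite -[X in measurable X]setTI; exact: mf.
Qed.

Hypothesis gaussW : forall s t : R, 0 <= s -> s < t -> forall B : set R, measurable B ->
  P [set w | B (W t w - W s w)] = normal_prob 0 (Num.sqrt (t - s)) B.

Let thr (j : nat) : R := 2^-1 ^+ j.
Let large j k := [set w | thr j < `|W (k.+1%:R / 16 ^+ j) w - W (k%:R / 16 ^+ j) w|].
Let bad j := \big[setU/set0]_(k < 512 ^ j) large j k.

Let mlarge j k : measurable (large j k).
Proof. exact: (measurable_increment _ _ (measurable_norm_gt (thr j))). Qed.

Let mbad j : measurable (bad j).
Proof. by apply: bigsetU_measurable => k _; exact: mlarge. Qed.

(** From 2 exp(- y) <= 240 / y^5 with y = 4^j / 4. The fifth power is the first to beat the union
    bound over 512^j increments, since 4^5 = 1024. *)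
Let C : R := 240 * 4 ^+ 5.

Let C0 : 0 <= C.
Proof. exact: mulr_ge0 (ler0n _ _) (exprn_ge0 _ (ler0n _ _)). Qed.

Let Plarge j k : (P (large j k) <= (C / 1024 ^+ j)%:E)%E.
Proof.
have p16 : 0 < (16 : R) ^+ j by rewrite exprn_gt0.
have ts : k.+1%:R / 16 ^+ j - k%:R / 16 ^+ j = (16 ^+ j)^-1 :> R.
  by rewrite -mulrBl -(natr1 k) addrAC subrr add0r mul1r.
rewrite /large (gaussW _ _ (measurable_norm_gt (thr j))); last 2 first.
- by rewrite divr_ge0// ltW.
- by rewrite -subr_gt0 ts invr_gt0.
rewrite ts.
have i16 : 0 < (16 ^+ j : R)^-1 by rewrite invr_gt0.
apply: le_trans (normal_tail _ _) _; first by rewrite gt_eqF// sqrtr_gt0.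
  by rewrite exprn_ge0.
rewrite lee_fin (sqr_sqrtr (ltW i16)).
have -> : thr j ^+ 2 / (4 * (16 ^+ j)^-1) = 4 ^+ j / 4.
  rewrite /thr -exprM mulnC exprM.
  have -> : (16 : R) ^+ j = 4 ^+ j * 4 ^+ j by rewrite -exprMn -natrM.
  have -> : (2^-1 ^+ 2 : R) = 4^-1 by rewrite exprVn -natrX.
  rewrite exprVn; field; rewrite gt_eqF// exprn_gt0//.
set y := 4 ^+ j / 4; have y0 : 0 < y by rewrite divr_gt0// exprn_gt0.
have := expR_ge1Dxn 4 (ltW y0).
have -> : 5`!%:R = 120 :> R by [].
move=> h; have h5 : y ^+ 5 / 120 <= expR y by lra.
rewrite expRN.
have -> : C / 1024 ^+ j = 2 * (y ^+ 5 / 120)^-1.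
  have -> : (1024 : R) ^+ j = (4 ^+ j) ^+ 5.
    by rewrite -exprM mulnC exprM; congr (_ ^+ _); rewrite -natrX.
  rewrite /y /C; field.
  by rewrite gt_eqF// exprn_gt0.
rewrite ler_pM2l// lef_pV2 ?posrE ?expR_gt0//.
by rewrite divr_gt0// exprn_gt0.
Qed.

Let Pbad j : (P (bad j) <= (2 * C / (2 ^ j.+1)%:R)%:E)%E.
Proof.
apply: (le_trans (Boole_inequality _ _)) => //.
apply: (@le_trans _ _ (\sum_(k < 512 ^ j) (C / 1024 ^+ j)%:E)%E).
  by apply: lee_sum => k _; exact: Plarge.
rewrite sumEFin lee_fin sumr_const card_ord -[leLHS]mulr_natr !natrX.
have -> : (1024 : R) ^+ j = 512 ^+ j * 2 ^+ j by rewrite -exprMn -natrM.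
move: C => c; rewrite [2 ^+ j.+1]exprS le_eqVlt; apply/orP; left; apply/eqP.
have : (512 : R) ^+ j != 0 by apply: expf_neq0; rewrite pnatr_eq0.
have : (2 : R) ^+ j != 0 by rewrite lt0r_neq0// exprn_gt0.
by move: (_ ^+ j) (_ ^+ j) => b a b0 a0; field; rewrite a0 b0.
Qed.

Lemma ae_increments_small : {ae P, forall w, increments_small (fun t => W t w)}.
Proof.
exists (lim_sup_set bad); split.
- by apply: bigcap_measurable => // n _; apply: bigcup_measurable => k _; exact: mbad.
- apply: lim_sup_set_cvg0 => //.
  apply: (@le_lt_trans _ _ ((2 * C)%:E)); last exact: ltry.
  have c0 : 0 <= 2 * C by rewrite mulr_ge0.
  apply: le_trans (epsilon_trick0 _ c0).
  by apply: lee_nneseries => // j _; exact: Pbad.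
move=> w /= ns n _; apply: contrapT => nb; apply: ns; exists n => j nj k kj.
rewrite leNgt; apply/negP => lk; apply: nb; exists j => //.
by rewrite /bad -bigcup_mkord; exists k.
Qed.
End brownian_increments.

(** * The Cameron-Martin formula *)

Import HBNNSimple.

(** * Transfer of weighted laws *)

Section integral_transfer.
Context d (T : measurableType d) (R : realType) (mu : {measure set T -> \bar R}).

(** The approximating sequence depends on [f] alone, so the right-hand side sees the space only
    through the weighted law of [X]. Two spaces can then be compared term by term. *)
Lemma weighted_integral_lim (X h : T -> R) (f : R -> R)
    (mf : measurable_fun [set: R] (EFin \o f)) :
  measurable_fun setT X -> measurable_fun setT h -> (forall w, 0 <= h w) ->
  (forall x, 0 <= f x) ->
  (\int[mu]_w (h w * f (X w))%:E =
   limn (fun n => \sum_(r \in range (nnsfun_approx measurableT mf n))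
     r%:E * \int[mu]_w (h w * \1_(nnsfun_approx measurableT mf n @^-1` [set r]) (X
       w))%:E))%E.
Proof.
move=> mX mh h0 f0.
pose f_ := nnsfun_approx (@measurableT _ R) mf.
have simple (g : {nnsfun R >-> R}) :
    (\int[mu]_w (h w * g (X w))%:E =
     \sum_(r \in range g) r%:E * \int[mu]_w (h w * \1_(g @^-1` [set r]) (X w))%:E)%E.
  pose A (r : R) : set R := g @^-1` [set r].
  have mA r : measurable (A r) by exact: measurable_sfunP.
  have mAX (r : R) : measurable_fun setT (fun w => \1_(A r) (X w) : R).
    apply: (measurableT_comp (f := (\1_(A r) : R -> R))) => //; exact: measurable_indic.
  have rA0 (r : R) (w : T) : 0 <= r * (\1_(A r) (X w) : R).
    rewrite indicE; case: (boolP (_ \in _)); rewrite ?mulr0// mulr1 inE => <-.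
    exact: fun_ge0.
  transitivity (\int[mu]_w \sum_(r \in range g) (h w * (r * \1_(A r) (X w)))%:E)%E.
    apply: eq_integral => w _; rewrite fsumEFin// -mulr_fsumr; congr (_ * _)%:E.
    by rewrite [in LHS]fimfunE.
  rewrite ge0_integral_fsum//.
  - apply: eq_fsbigr => r /[!inE] -[x _ gx].
    under eq_integral do rewrite mulrCA EFinM.
    rewrite ge0_integralZl_EFin//.
    + by move=> w _; rewrite lee_fin mulr_ge0.
    + by apply/measurable_EFinP/measurable_funM.
    + by rewrite -gx.
  - by move=> r; apply/measurable_EFinP/measurable_funM => //; exact: measurable_funM.
  - by move=> r w _; rewrite lee_fin mulr_ge0.
transitivity (limn (fun n => \int[mu]_w (h w * f_ n (X w))%:E))%E.
  rewrite -monotone_convergence//.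
  - apply: eq_integral => w _; apply/esym/cvg_lim => //.
    rewrite EFinM; under eq_fun do rewrite EFinM.
    apply: cvgeZl => //.
    by apply: cvg_nnsfun_approx => // *; rewrite lee_fin.
  - move=> n; apply/measurable_EFinP/measurable_funM => //.
    by apply: measurableT_comp => //; exact: measurable_funPT.
  - by move=> n w _; rewrite lee_fin mulr_ge0.
  - move=> w _ m n mn; rewrite lee_fin ler_wpM2l//.
    exact/lefP/nd_nnsfun_approx.
by under eq_fun do rewrite simple.
Qed.
End integral_transfer.

(** The weights allow two uses: the product of the other factors in [indep_prod], and a Gaussian
    density against Lebesgue measure in [tilt_increment]. *)
Lemma integral_transfer d1 (T1 : measurableType d1) d2 (T2 : measurableType d2)
    (R : realType) (mu1 : {measure set T1 -> \bar R}) (mu2 : {measure set T2 -> \bar R})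
    (X1 h1 : T1 -> R) (X2 h2 : T2 -> R) :
  measurable_fun setT X1 -> measurable_fun setT h1 -> (forall w, 0 <= h1 w) ->
  measurable_fun setT X2 -> measurable_fun setT h2 -> (forall w, 0 <= h2 w) ->
  (forall B : set R, measurable B ->
    \int[mu1]_w (h1 w * \1_B (X1 w))%:E = \int[mu2]_w (h2 w * \1_B (X2 w))%:E)%E ->
  forall f : R -> R, measurable_fun setT f -> (forall x, 0 <= f x) ->
    (\int[mu1]_w (h1 w * f (X1 w))%:E = \int[mu2]_w (h2 w * f (X2 w))%:E)%E.
Proof.
move=> mX1 mh1 h10 mX2 mh2 h20 H f mf f0.
have mfE : measurable_fun [set: R] (EFin \o f) by exact/measurable_EFinP.
rewrite (weighted_integral_lim mu1 mfE)// (weighted_integral_lim mu2 mfE)//.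
have mA (g : {nnsfun R >-> R}) r : measurable (g @^-1` [set r]) by exact: measurable_sfunP.
by congr (limn _); apply/funext => n; apply: eq_fsbigr => r _; rewrite H//; exact: mA.
Qed.

Lemma integral_indic_comp d (T : measurableType d) (R : realType)
    (mu : {measure set T -> \bar R}) (X : T -> R) (B : set R) :
  measurable_fun setT X -> measurable B ->
  (\int[mu]_w (\1_B (X w))%:E = mu [set w | B (X w)])%E.
Proof.
move=> mX mB; rewrite -[X in (_ = mu X)%E]setIT -integral_indic//=.
by rewrite -[X in measurable X]setTI; exact: mX.
Qed.

Section indep_prod.
Context d (T : measurableType d) (R : realType) (P : probability T R).
Variables (N : nat) (D : nat -> T -> R).
Hypothesis mD : forall i, measurable_fun setT (D i).
Hypothesis indepD : forall B : nat -> set R, (forall i, measurable (B i)) ->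
  P [set w | forall i, (i < N)%N -> B i (D i w)] =
    (\prod_(i < N) P [set w | B i (D i w)])%E.

Let mDB i (B : set R) : measurable B -> measurable [set w | B (D i w)].
Proof. by move=> mB; rewrite -[X in measurable X]setTI; exact: mD. Qed.

Let prod_indic (B : nat -> set R) : (forall i, measurable (B i)) ->
  (\int[P]_w (\prod_(i < N) (\1_(B i) (D i w) : R))%:E =
   \prod_(i < N) \int[P]_w (\1_(B i) (D i w))%:E)%E.
Proof.
move=> mB; under [RHS]eq_bigr do rewrite integral_indic_comp//.
rewrite -indepD//.
have mE : measurable [set w | forall i, (i < N)%N -> B i (D i w)].
  rewrite (_ : [set _ | _] = \bigcap_(i in `I_N) [set w | B i (D i w)]); last first.
    by apply/seteqP; split => w /= H i; exact: H.
  by apply: bigcap_measurableType => i _; exact: mDB.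
rewrite -[X in (_ = P X)%E]setIT -integral_indic//=.
apply: eq_integral => w _; congr _%:E; rewrite indicE.
have [H|H] := boolP (w \in _).
  rewrite big1// => i _; rewrite indicE mem_set//; move: H; rewrite inE; exact.
have [i nB] : exists i : 'I_N, ~ B i (D i w).
  apply: contrapT => nB; move: H; rewrite notin_setE; apply => i iN.
  by apply: contrapT => nBi; apply: nB; exists (Ordinal iN).
by rewrite (bigD1 i)//= indicE memNset// mul0r.
Qed.

(** Indicators are replaced by functions one factor at a time: [G j] has functions below j and
    indicators from j on. The induction keeps the sets quantified because its step calls the
    previous case with an arbitrary set at j. Finite integrals make the product of the other factors
    a real constant. *)
Lemma indep_prod (F : nat -> R -> R) :
  (forall i, measurable_fun setT (F i)) -> (forall i x, 0 <= F i x) ->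
  (forall i, (\int[P]_w (F i (D i w))%:E < +oo)%E) ->
  (\int[P]_w (\prod_(i < N) F i (D i w))%:E = \prod_(i < N) \int[P]_w (F i (D i w))%:E)%E.
Proof.
move=> mF F0 Ffin.
pose G j (B : nat -> set R) i : R -> R := if (i < j)%N then F i else \1_(B i).
have mG j B i : (forall i, measurable (B i)) -> measurable_fun setT (G j B i).
  by move=> mB; rewrite /G; case: ifP => // _; exact: measurable_indic.
have G0 j B i x : 0 <= G j B i x by rewrite /G; case: ifP.
have Gfin j B i : (forall i, measurable (B i)) ->
    (\int[P]_w (G j B i (D i w))%:E)%E \is a fin_num.
  move=> mB; rewrite ge0_fin_numE; last by apply: integral_ge0 => w _; rewrite lee_fin.
  rewrite /G; case: ifP => // _; rewrite integral_indic_comp//.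
  by rewrite (le_lt_trans (probability_le1 _ _)) ?ltry//; exact: mDB.
have main j (B : nat -> set R) : (j <= N)%N -> (forall i, measurable (B i)) ->
   (\int[P]_w (\prod_(i < N) G j B i (D i w))%:E =
    \prod_(i < N) \int[P]_w (G j B i (D i w))%:E)%E.
  elim: j B => [|j IH] B jN mB; first exact: prod_indic.
  pose J := Ordinal jN.
  pose h w := \prod_(i < N | i != J) G j.+1 B i (D i w).
  pose C := \prod_(i < N | i != J) fine (\int[P]_w (G j.+1 B i (D i w))%:E)%E.
  have CE : C%:E = (\prod_(i < N | i != J) \int[P]_w (G j.+1 B i (D i w))%:E)%E.
    by rewrite /C -prodEFin; apply: eq_bigr => i _; rewrite fineK// Gfin.
  rewrite (bigD1 J)//= -CE muleC.
  rewrite [in RHS]/G ltnSn.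
  under eq_integral do rewrite (bigD1 J)//= [X in (X * _)%:E]/G ltnSn mulrC.
  have C0 : 0 <= C.
    by apply: prodr_ge0 => i _; apply: fine_ge0; apply: integral_ge0 => w _;
      rewrite lee_fin.
  have CZ (f : R -> R) : measurable_fun setT f -> (forall x, 0 <= f x) ->
      (C%:E * \int[P]_w (f (D j w))%:E = \int[P]_w (C * f (D j w))%:E)%E.
    move=> mf f0; under [RHS]eq_integral do rewrite EFinM.
    rewrite ge0_integralZl_EFin//; last by apply/measurable_EFinP/measurableT_comp.
    by move=> w _; rewrite lee_fin.
  rewrite CZ//; apply: (integral_transfer (h1 := h) (h2 := cst C)) => //.
  - rewrite (_ : h = fun w => \prod_(i < N) if i != J then G j.+1 B i (D i w) else 1).
      apply: measurable_prod => i _; case: (i != J) => //.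
      by apply: measurableT_comp => //; exact: mG.
    by apply/funext => w; rewrite /h big_mkcond.
  - by move=> w; apply: prodr_ge0 => i _.
  move=> B' mB'; rewrite -CZ//.
  pose B1 i := if i == j then B' else B i.
  have mB1 i : measurable (B1 i) by rewrite /B1; case: ifP.
  have E i : i != J -> G j B1 i = G j.+1 B i.
    move=> iJ; rewrite /G /B1 ltnS [(i <= j)%N]leq_eqVlt.
    have /negPf -> : (i != j :> nat) by [].
    by [].
  have EJ : G j B1 j = \1_B' by rewrite /G /B1 ltnn eqxx.
  have := IH B1 (ltnW jN) mB1.
  rewrite [X in _ = X -> _](bigD1 J)//= EJ.
  under eq_integral do rewrite (bigD1 J)//= EJ mulrC.
  rewrite muleC CE => H; rewrite (eq_bigr (fun i :
    'I_N => \int[P]_w (G j B1 i (D i w))%:E)%E); last first.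
    by move=> i iJ; rewrite E.
  rewrite -H; apply: eq_integral => w _; congr (_ * _)%:E.
  by apply: eq_bigr => i iJ; rewrite E.
have := main N (fun=> set0) (leqnn _) (fun=> measurable0).
rewrite [X in _ = X -> _](eq_bigr (fun i : 'I_N => \int[P]_w (F i (D i w))%:E)%E);
  last first.
  by move=> i _; rewrite /G ltn_ord.
move=> <-; apply: eq_integral => w _; congr _%:E.
by apply: eq_bigr => i _; rewrite /G ltn_ord.
Qed.
End indep_prod.

(** * Cameron-Martin on sets of increments *)

Section cameron_martin.
Context d (T : measurableType d) (R : realType) (P : probability T R).
Variables (W : R -> {RV P >-> R}) (s c : R).
Hypothesis s0 : 0 <= s.
Hypothesis gaussW : forall s t : R, 0 <= s -> s < t -> forall B : set R, measurable B ->
  P [set w | B (W t w - W s w)] = normal_prob 0 (Num.sqrt (t - s)) B.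
Hypothesis indepW : forall (n : nat) (t : nat -> R) (B : nat -> set R),
  0 <= t 0%N -> (forall i, (i < n)%N -> t i <= t i.+1) ->
  (forall i, measurable (B i)) ->
  P [set w | forall i, (i < n)%N -> B i (W (t i.+1) w - W (t i) w)] =
  (\prod_(i < n) P [set w | B i (W (t i.+1) w - W (t i) w)%R])%E.

Definition sample_path (w : T) (t : R) : R := W t w.

(** Density of the normal law of mean [m] and variance [v] with respect to the centred one. *)
Definition tilt (m v x : R) := expR (m * x / v - m ^+ 2 / (2 * v)).

Lemma measurable_tilt m v : measurable_fun setT (tilt m v).
Proof.
apply: measurableT_comp => //; apply: measurable_funB => //.
by apply: measurable_funM => //; exact: measurable_funM.
Qed.

Let mincr a b : measurable_fun setT (fun w => W b w - W a w).
Proof. by apply: measurable_funB; exact: measurable_funPT. Qed.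

Lemma tilt_increment a b m (B : set R) : 0 <= a -> a < b -> measurable B ->
  P [set w | B (W b w - W a w + m)] =
  (\int[P]_w (tilt m (b - a) (W b w - W a w) * \1_B (W b w - W a w))%:E)%E.
Proof.
move=> a0 ab mB; set v := b - a; have v0 : 0 < v by rewrite subr_gt0.
have sv0 : Num.sqrt v != 0 by rewrite gt_eqF// sqrtr_gt0.
have sv2 : Num.sqrt v ^+ 2 = v by rewrite sqr_sqrtr// ltW.
have mt : measurable (translate m @^-1` B).
  by rewrite -[X in measurable X]setTI; exact: measurable_translate.
rewrite [LHS](gaussW a0 ab mt) normal_prob_translate//.
pose f x := tilt m v x * (\1_B x : R).
have mf : measurable_fun setT f.
  by apply: measurable_funM; [exact: measurable_tilt|exact: measurable_indic].
have f0 x : 0 <= f x by rewrite mulr_ge0// expR_ge0.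
have := @integral_transfer _ _ _ (measurableTypeR R) R P (@lebesgue_measure R)
  (fun w => W b w - W a w) (cst 1) idfun (normal_pdf 0 (Num.sqrt v)).
move=> /(_ (mincr a b) (measurable_cst _) (fun=> ler01)).
move=> /(_ (@measurable_id _ _ _) (measurable_normal_pdf _ _) (normal_pdf_ge0 _ _)).
have toset (g : R -> R) (A : set R) :
   (\int[lebesgue_measure]_(x in A) (g x)%:E =
     \int[lebesgue_measure]_x (g x * (\1_A x : R))%:E)%E.
  rewrite integral_mkcond; apply: eq_integral => x _; rewrite patchE indicE.
  by case: (x \in A); rewrite ?mulr1 ?mulr0.
have HA (A : set R) : measurable A ->
    (\int[P]_w (cst 1 w * \1_A (W b w - W a w))%:E =
     \int[lebesgue_measure]_x (normal_pdf 0 (Num.sqrt v) x * (\1_A x : R))%:E)%E.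
  move=> mA; under eq_integral do rewrite mul1r.
  rewrite integral_indic_comp//.
  by rewrite -toset; exact: gaussW.
move=> /(_ HA f mf f0); under eq_integral do rewrite mul1r.
move=> ->; rewrite /normal_prob toset; apply: eq_integral => x _; congr (_%:E).
by rewrite /f normal_pdf_tilt// sv2 /tilt /=; ring.
Qed.

Lemma measurable_all_lt N (f : nat -> T -> R) (B : nat -> set R) :
  (forall k, measurable_fun setT (f k)) -> (forall k, measurable (B k)) ->
  measurable [set w | forall k, (k < N)%N -> B k (f k w)].
Proof.
move=> mf mB.
rewrite (_ : [set _ | _] = \bigcap_(k in `I_N) (f k @^-1` B k)).
  apply: bigcap_measurableType => k _.
  by rewrite -[X in measurable X]setTI; exact: mf.
by apply/seteqP; split => w /= H k; exact: H.
Qed.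

Definition gain w := expR (c * (W (s + 1) w - W s w) - c ^+ 2 / 2).

Lemma measurable_gain : measurable_fun setT gain.
Proof.
apply: measurableT_comp => //; apply: measurable_funB => //.
exact: measurable_funM.
Qed.

Let incr n k w := W (grid s n k.+1) w - W (grid s n k) w.
Let drft n k := c * ((k < 2 ^ n)%N%:R / 2 ^+ n).
Let fac n k (x : R) := tilt (drft n k) (grid s n k.+1 - grid s n k) x.

(** Over the ramp the increments telescope and the quadratic terms add up to c^2 / 2; after it the
    shift has no increments and the factors are 1. *)
Let prod_tilt n K w : \prod_(k < 2 ^ n + K) fac n k (incr n k w) = gain w.
Proof.
have h0 := @mesh_gt0 R n.
rewrite big_split_ord/= [X in _ * X]big1 ?mulr1; last first.
  move=> i _; rewrite /fac /drft ltnNge leq_addr/= mul0r mulr0 /tilt.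
  by rewrite mul0r mul0r expr0n/= mul0r subrr expR0.
rewrite (eq_bigr (fun k : 'I_(2 ^ n) =>
  expR (c * incr n k w - c ^+ 2 / (2 * 2 ^+ n)))); last first.
  move=> i _; rewrite /fac /tilt gridS /drft ltn_ord addrAC subrr add0r /= mulr1n mul1r.
  by congr expR; field; rewrite lt0r_neq0// exprn_gt0.
rewrite -expR_sum sumrB -mulr_sumr sumr_const card_ord -[X in _ - X]mulr_natr natrX /gain.
have -> : \sum_(i < 2 ^ n) incr n i w = W (s + 1) w - W s w.
  rewrite -(big_mkord xpredT (fun i => incr n i w)) /incr.
  rewrite (@telescope_sumr_eq _ 0 (2 ^ n) (fun k => W (grid s n k) w))//.
  by rewrite /grid mulr0n mul0r addr0 natrX mulfV// lt0r_neq0// exprn_gt0.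
by congr expR; congr (_ - _); field; rewrite lt0r_neq0// exprn_gt0.
Qed.

(** At least 2^n increments occur, so the whole ramp is covered and the density is the same [gain]
    for every mesh and every [K]. *)
Definition cylinder n K (B : nat -> set R) : set (R -> R) :=
  [set p | forall k, (k < 2 ^ n + K)%N -> B k (p (grid s n k.+1) - p (grid s n k))].

Definition cm_event (A : set (R -> R)) :=
  [/\ measurable [set w | A (shifted s (sample_path w) c)],
    measurable [set w | A (sample_path w)] &
    P [set w | A (shifted s (sample_path w) c)] =
    (\int[P]_(w in [set w | A (sample_path w)]) (gain w)%:E)%E].

Lemma cm_cylinder n K (B : nat -> set R) : (forall k, measurable (B k)) ->
  cm_event (cylinder n K B).
Proof.
move=> mB; set N := (2 ^ n + K)%N.
have mi k : measurable_fun setT (incr n k) by exact: mincr.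
have gS k : grid s n k < grid s n k.+1 by rewrite gridS ltrDl mesh_gt0.
have gge k : 0 <= grid s n k := le_trans s0 (grid_ge s n k).
have mBt k : measurable (translate (drft n k) @^-1` B k).
  by rewrite -[X in measurable X]setTI;
    exact: (measurable_translate (drft n k) measurableT (mB k)).
have E1 : [set w | cylinder n K B (shifted s (sample_path w) c)] =
    [set w | forall k, (k < N)%N -> (translate (drft n k) @^-1` B k) (incr n k w)].
  apply/seteqP; split => w H k kN; have := H k kN; rewrite shifted_gridS//.
have E2 : [set w | cylinder n K B (sample_path w)] =
  [set w | forall k, (k < N)%N -> B k (incr n k w)] by [].
have m2 : measurable [set w | cylinder n K B (sample_path w)].
  by rewrite E2; exact: measurable_all_lt.
split => //; first by rewrite E1; exact: (measurable_all_lt N mi mBt).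
pose F k (x : R) := fac n k x * (\1_(B k) x : R).
have PF k : P [set w | (translate (drft n k) @^-1` B k) (incr n k w)] =
    (\int[P]_w (F k (incr n k w))%:E)%E by exact: tilt_increment.
rewrite E1 (indepW _ _ mBt)//; last by move=> k _; exact/ltW.
under eq_bigr do rewrite PF.
rewrite -indep_prod//.
- rewrite [RHS]integral_mkcond; apply: eq_integral => w _;
  rewrite patchE /F big_split/= prod_tilt.
  have [H|H] := boolP (w \in _).
    rewrite big1 ?mulr1// => k _; rewrite indicE mem_set//.
    by move: H; rewrite inE E2 /=; apply.
  have [k nB] : exists k : 'I_N, ~ B k (incr n k w).
    apply: contrapT => nB; move: H; rewrite notin_setE; apply => k kN.
    by apply: contrapT => nBi; apply: nB; exists (Ordinal kN).
  by rewrite (bigD1 k)//= indicE memNset// mul0r mulr0.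
- by move=> B' mB'; apply: indepW => // k _; exact/ltW.
- by move=> k; apply: measurable_funM; [exact: measurable_tilt|exact: measurable_indic].
- by move=> k x; rewrite mulr_ge0// expR_ge0.
- move=> k; rewrite -PF (le_lt_trans (probability_le1 _ _)) ?ltry//.
  by rewrite -[X in measurable X]setTI; exact: mi.
Qed.

Lemma cm_dynkin : dynkin cm_event.
Proof.
(* The trivial cylinder gives total mass 1, on which the case of complements relies. *)
have i1 : (\int[P]_(w in setT) (gain w)%:E = 1)%E.
  have [_ _] := @cm_cylinder 0%N 0%N (fun=> setT) (fun=> measurableT).
  have e (f : T -> R -> R) : [set w | cylinder 0 0 (fun=> setT) (f w)] =
    setT by apply/seteqP.
  by rewrite !e probability_setT => <-.
have mg (A : set T) : measurable_fun A (EFin \o gain).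
  by apply/measurable_EFinP; apply: measurable_funTS; exact: measurable_gain.
have g0 w : (0 <= (gain w)%:E)%E by rewrite lee_fin expR_ge0.
split.
- have eT (f : T -> R -> R) : [set w | [set: R -> R] (f w)] = setT by apply/seteqP.
  by split; rewrite !eT// i1 probability_setT.
- move=> A [m1 m2 PA]; split; [exact: measurableC|exact: measurableC|].
  rewrite [LHS](probability_setC P m1) PA.
  have : (\int[P]_(w in [set w | A (sample_path w)]) (gain w)%:E +
      \int[P]_(w in ~` [set w | A (sample_path w)]) (gain w)%:E = 1)%E.
    rewrite -i1 -[in RHS](setUv [set w | A (sample_path w)]) ge0_integral_setU//.
      exact: measurableC.
    by apply/disj_setPS; rewrite setICr.
  move=> <-; rewrite addeAC subee ?add0e//.
  by rewrite -PA fin_num_measure.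
- move=> F tF HF.
  have t1 (f : T -> R -> R) : trivIset setT (fun k => [set w | F k (f w)]).
    apply/trivIsetP => i j _ _ ij; apply/seteqP; split => // w [/= Fi Fj].
    by have /trivIsetP/(_ i j I I ij) := tF; move/seteqP => [/(_ (f w) (conj Fi Fj))].
  have e (f : T -> R -> R) : [set w | (\bigcup_k F k) (f w)] =
    \bigcup_k [set w | F k (f w)] by [].
  split; rewrite !e.
  + by apply: bigcup_measurable => k _; have [] := HF k.
  + by apply: bigcup_measurable => k _; have [] := HF k.
  rewrite measure_bigcup//=; last by move=> k _; have [] := HF k.
  rewrite ge0_integral_bigcup//; last by move=> k; have [] := HF k.
  transitivity (\sum_(0 <= k <oo) P [set w | F k (shifted s (sample_path w) c)])%E.
    by apply: eq_eseriesl => k; rewrite in_setT.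
  by apply: eq_eseriesr => k _; have [] := HF k.
Qed.

Definition level n : set_system (R -> R) :=
  [set A | exists K B, (forall k, measurable (B k)) /\ A = cylinder n K B].

Lemma level_setI n : setI_closed (level n).
Proof.
move=> _ _ [K [B [mB ->]]] [K' [B' [mB' ->]]].
exists (maxn K K'), (fun k => (if (k < 2 ^ n + K)%N then B k else setT) `&`
  (if (k < 2 ^ n + K')%N then B' k else setT)); split.
  by move=> k; apply: measurableI; case: ifP.
apply/seteqP; split => p.
  by move=> [H H'] k _; split; case: ifP => // kK; [exact: H|exact: H'].
move=> H; split => k kK.
  have kM : (k < 2 ^ n + maxn K K')%N by rewrite (leq_trans kK)// leq_add2l leq_maxl.
  by have [] := H k kM; rewrite kK.
have kM : (k < 2 ^ n + maxn K K')%N by rewrite (leq_trans kK)// leq_add2l leq_maxr.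
by have [_] := H k kM; rewrite kK.
Qed.

Lemma cm_level n : <<s level n >> `<=` cm_event.
Proof.
apply: lambda_system_subset => //; first exact: level_setI.
  exact/dynkin_lambda_system/cm_dynkin.
by move=> _ [K [B [mB ->]]]; exact: cm_cylinder.
Qed.
End cameron_martin.

(** * Measurability of the trapped event *)

Section trapped_measurable.
Context {R : realType}.
Variable s : R.

Local Notation lev n := (g_sigma_algebraType (level s n)).

Lemma measurable_level_increment n k :
  measurable_fun setT (fun p : lev n => p (grid s n k.+1) - p (grid s n k)).
Proof.
move=> _ B mB; rewrite setTI; apply: sub_gen_smallest.
exists k.+1, (fun i => if i == k then B else setT); split; first by move=> i; case: ifP.
apply/seteqP; split => p /=.
  by move=> Bp i _; case: eqP => // ->.
by move=> /(_ k); rewrite eqxx; apply; rewrite addnS ltnS leq_addl.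
Qed.

Lemma gridD n k : grid s n.+1 k.*2 = grid s n k :> R.
Proof.
rewrite /grid exprS -muln2 natrM; congr (_ + _); field.
by rewrite lt0r_neq0// exprn_gt0.
Qed.

(** A coarse increment is the sum of two fine ones. *)
Lemma level_nested n : <<s level s n >> `<=` <<s level s n.+1 >>.
Proof.
apply: smallest_sub; first exact: smallest_sigma_algebra.
move=> _ [K [B [mB ->]]].
have mi k : measurable_fun setT (fun p : lev n.+1 => p (grid s n k.+1) - p (grid s n k)).
  rewrite (_ : (fun p => _) = fun p : lev n.+1 =>
      (p (grid s n.+1 k.*2.+2) - p (grid s n.+1 k.*2.+1)) +
      (p (grid s n.+1 k.*2.+1) - p (grid s n.+1 k.*2))).
    by apply: measurable_funD; exact: measurable_level_increment.
  by apply/funext => p; rewrite -doubleS !gridD; ring.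
exact: (@measurable_all_lt _ (lev n.+1) R (2 ^ n + K) _ _ mi mB).
Qed.

Lemma level_le m n : (m <= n)%N -> <<s level s m >> `<=` <<s level s n >>.
Proof.
move=> mn; rewrite -(subnKC mn); elim: (n - m)%N => [|k IH]; first by rewrite addn0.
by rewrite addnS; apply: subset_trans IH _; exact: level_nested.
Qed.

(** Cylinders of different meshes need not intersect in a cylinder. The pi-lambda argument is
    therefore run twice: inside each level, then on this union, which is closed under intersection
    because the levels are nested. *)
Definition levels : set_system (R -> R) := \bigcup_n <<s level s n >>.

Lemma levels_setI : setI_closed levels.
Proof.
move=> A B [m _ Am] [n _ Bn]; exists (maxn m n) => //.
have A' := level_le (leq_maxl m n) Am; have B' := level_le (leq_maxr m n) Bn.
exact: (@measurableI _ (lev (maxn m n)) _ _ A' B').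
Qed.

Lemma measurable_euler x0 sigma n k :
  measurable_fun setT (fun p : lev n => euler s x0 sigma p n k).
Proof.
elim: k => [|k IH] /=; first exact: measurable_cst.
apply: measurable_funD.
  apply: measurable_funD => //; apply: measurable_funM => //.
  by apply: measurable_funM => //; apply: measurable_funB.
by apply: measurable_funM => //; exact: measurable_level_increment.
Qed.

Lemma measurable_trapped x0 sigma : <<s levels >> [set p | trapped s x0 sigma p].
Proof.
pose E n k (b : R) := [set p : R -> R | `|euler s x0 sigma p n k - grid s n k| <= b].
have mE n k b : <<s levels >> (E n k b).
  apply: sub_gen_smallest; exists n => //.
  have mf : measurable_fun setT (fun p : lev n => `|euler s x0 sigma p n k - grid s n k|).
    by apply: measurableT_comp => //; apply: measurable_funB => //; exact: measurable_euler.
  have := mf measurableT _ (measurable_itv `]-oo, b]); rewrite setTI.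
  by congr (<<s _ >> _); apply/seteqP; split => p /=; rewrite in_itv.
rewrite (_ : [set p | _] = \bigcup_(B : nat) \bigcap_(T : nat) \bigcup_(N : nat)
   \bigcap_(n in [set n | (N <= n)%N]) \bigcap_(k in [set k | (k <=
     T * 2 ^ n)%N]) E n k B%:R).
  apply: (@bigcup_measurable _ (g_sigma_algebraType levels)) => B _.
  apply: (@bigcap_measurableType _ (g_sigma_algebraType levels)) => T _.
  apply: (@bigcup_measurable _ (g_sigma_algebraType levels)) => N _.
  apply: (@bigcap_measurableType _ (g_sigma_algebraType levels)) => n _.
  by apply: (@bigcap_measurableType _ (g_sigma_algebraType levels)) => k _; exact: mE.
apply/seteqP; split => p /=.
  move=> [B H]; exists B => // T _; have [N HN] := H T.
  by exists N => // n Nn k; exact: HN.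
move=> [B _ H]; exists B => T; have [N _ HN] := H T I.
by exists N => n Nn k kT; exact: HN.
Qed.
End trapped_measurable.

(** * Nullity of the trapped event *)

Section trapped_null.
Context d (T : measurableType d) (R : realType) (P : probability T R).
Variables (W : R -> {RV P >-> R}) (s x0 sigma : R).
Hypotheses (s0 : 0 <= s) (sigma0 : 0 < sigma).
Hypothesis gaussW : forall s t : R, 0 <= s -> s < t -> forall B : set R, measurable B ->
  P [set w | B (W t w - W s w)] = normal_prob 0 (Num.sqrt (t - s)) B.
Hypothesis indepW : forall (n : nat) (t : nat -> R) (B : nat -> set R),
  0 <= t 0%N -> (forall i, (i < n)%N -> t i <= t i.+1) ->
  (forall i, measurable (B i)) ->
  P [set w | forall i, (i < n)%N -> B i (W (t i.+1) w - W (t i) w)] =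
  (\prod_(i < n) P [set w | B i (W (t i.+1) w - W (t i) w)%R])%E.

Lemma cm_trapped c : cm_event W s c [set p | trapped s x0 sigma p].
Proof.
have := @measurable_trapped R s x0 sigma; move: [set p | _].
apply: lambda_system_subset => //; first exact: levels_setI.
  exact/dynkin_lambda_system/cm_dynkin.
by move=> A [n _]; exact: cm_level.
Qed.

Lemma trapped_null : P [set w | trapped s x0 sigma (sample_path W w)] = 0%E.
Proof.
set M0 := [set w | _].
have mM0 : measurable M0 by have [] := cm_trapped 0.
pose Z w := W (s + 1) w - W s w.
pose q w := expR (- `|Z w| - 1 / 2).
have mq : measurable_fun setT q.
  apply: measurableT_comp => //; apply: measurable_funB => //.
  do 2 apply: measurableT_comp => //.
  by apply: measurable_funB; exact: measurable_funPT.
have mqE (A : set T) : measurable_fun A (EFin \o q).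
  by apply/measurable_EFinP; exact: measurable_funTS.
pose K := (\int[P]_(w in M0) (q w)%:E)%E.
pose c i : R := i.+1%:R^-1.
pose M i := [set w | trapped s x0 sigma (shifted s (sample_path W w) (c i))].
have mM i : measurable (M i) by have [] := cm_trapped (c i).
have KM i : (K <= P (M i))%E.
  have [_ _ ->] := cm_trapped (c i); apply: ge0_le_integral => //.
  - by move=> w _; rewrite lee_fin expR_ge0.
  - by apply/measurable_EFinP; apply: measurable_funTS; exact: measurable_gain.
  move=> w _; rewrite lee_fin ler_expR -/(Z w).
  have c0 : 0 <= c i by rewrite invr_ge0.
  have c1 : c i <= 1 by rewrite invf_le1// ler1n.
  have h1 : - `|Z w| <= c i * Z w.
    rewrite lerNl -mulrN (le_trans (ler_norm _))// normrM normrN (ger0_norm c0).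
    by rewrite ler_piMl.
  have h2 : c i ^+ 2 <= 1 by rewrite expr_le1.
  lra.
have tM : trivIset setT M.
  apply/trivIsetP => i j _ _ ij; apply/seteqP; split => // w [/= Mi Mj].
  have : c i != c j by rewrite /c (inj_eq invr_inj) eqr_nat eqSS.
  rewrite neq_lt => /orP[] h.
    exact: (trapped_shifted_disjoint s0 sigma0 h Mi Mj).
  exact: (trapped_shifted_disjoint s0 sigma0 h Mj Mi).
have K0 : (0 <= K)%E by apply: integral_ge0 => w _; rewrite lee_fin expR_ge0.
have Kf : K = (fine K)%:E.
  rewrite fineK// ge0_fin_numE// (le_lt_trans (KM 0%N))//.
  by rewrite (le_lt_trans (probability_le1 P (mM 0%N)))// ltry.
have nK n : n%:R * fine K <= 1.
  rewrite -lee_fin; apply: (@le_trans _ _ (P (\big[setU/set0]_(i < n) M i))).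
    rewrite measure_bigsetU//; apply: (@le_trans _ _ (\sum_(i < n) (fine K)%:E)%E).
      by rewrite sumEFin sumr_const card_ord mulr_natl.
    by apply: lee_sum => i _; rewrite -Kf; exact: KM.
  by apply: probability_le1; apply: bigsetU_measurable => i _; exact: mM.
have K1 : K = 0%E.
  rewrite Kf; congr _%:E; apply/eqP; rewrite eq_le fine_ge0// andbT leNgt; apply/negP => Kp.
  have := archi_boundP (ltW (eqbRL (invr_gt0 (fine K)) Kp)).
  rewrite -[_^-1]mul1r ltr_pdivrMr// ltNge => /negP; apply; exact: nK.
(* A vanishing integral of the positive function [q] over [M0] forces [M0] to be null. *)
have : (\int[P]_(w in M0) `|(q w)%:E| = 0)%E.
  by rewrite -K1; apply: eq_integral => w _; rewrite gee0_abs// lee_fin expR_ge0.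
move=> /(ae_eq_integral_abs P mM0 (mqE M0))[N [mN PN sN]].
apply/(measure_negligible mM0); exists N; split => //.
apply: subset_trans sN => w M0w /= /(_ M0w) [] /eqP.
by rewrite gt_eqF// expR_gt0.
Qed.
End trapped_null.

(** * Conclusion *)

Section pathwise.
Context {R : realType}.

(** [A] is a variable because the half-line appears once as the lifetime of a solution and once as
    an interval. *)
Lemma cont_from_within (s : R) (A : set R) (g : R -> R) : A = [set t | s <= t] ->
  {within A, continuous g} -> cont_from s g.
Proof.
move=> -> /subspace_continuousP cg t st e e0.
have /cvgrPdist_lt/(_ e e0) := cg t st.
rewrite near_withinE => /nbhs_ballP[d /= d0 H]; exists d => // u su ud.
by rewrite distrC; apply: H => //; rewrite /ball/= distrC.
Qed.

Lemma is_solution_solves (sigma s x0 : R) (w : R -> R) (X : R -> \bar R) :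
  is_solution sigma w s x0 X -> blowup_time s X = +oo%E ->
  [/\ forall t, s <= t -> X t \is a fin_num, fine (X s) = x0 &
    solves s (fun t => fine (X t)) (fun t => sigma * w t)].
Proof.
move=> [_ fX cX eX _] bX; rewrite bX in fX cX eX.
have {}fX t : s <= t -> X t \is a fin_num by move=> st; apply: fX => //; rewrite ltry.
have {}eX t (st : s <= t) := eX t st (ltry _).
set x := fun t => fine (X t) in eX *.
have cx : cont_from s x.
  apply: cont_from_within cX; apply/seteqP; split => t /=; first by case.
  by move=> st; rewrite ltry.
split => //.
  by rewrite eX// set_itv1 Rintegral_set1 subrr mulr0 !addr0.
have cm : continuous (fun u => Num.max s u).
  have := cont_from_clamp (@cont_from_affine _ s 1 0).
  by under eq_fun do rewrite mul1r addr0.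
have cc := cont_from_clamp cx.
have cf : continuous (fun u => drift x (Num.max s u)).
  move=> u; apply: (@cvgM _ R^o); first exact: cc.
  by apply: (@cvgB _ R^o); [exact: cc|exact: cm].
(* On [s, t] the drift agrees with its clamped version, which is continuous on the whole line. *)
have intf t : lebesgue_measure.-integrable `[s, t] (EFin \o drift x).
  apply: (@eq_integrable _ _ _ lebesgue_measure `[s, t] _ (EFin \o (fun u =>
    drift x (Num.max s u)))) => //.
    by move=> u; rewrite inE /= in_itv/= => /andP[su _]; rewrite (max_idPr su).
  apply: continuous_compact_integrable; first exact: segment_compact.
  exact: continuous_subspaceT.
have incr t1 t2 : s <= t1 -> t1 <= t2 ->
    x t2 - x t1 - (sigma * w t2 - sigma * w t1) =
    \int[lebesgue_measure]_(u in `]t1, t2]) drift x u.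
  move=> st1 t12; have st2 := le_trans st1 t12.
  have := @Rintegral_itvB R (drift x) (BLeft s) (BRight t2) t1 (intf t2).
  rewrite !bnd_simp => /(_ st1 t12) <-.
  by rewrite [x t1](eX _ st1) [x t2](eX _ st2) /drift; ring.
have intS t1 t2 : s <= t1 -> lebesgue_measure.-integrable `]t1, t2] (EFin \o drift x).
  move=> st1; apply: integrableS (intf t2) => //.
  by move=> u /=; rewrite !in_itv/= => /andP[h ->]; rewrite (le_trans st1 (ltW h)).
have intC (t1 t2 m : R) : t1 <= t2 ->
    m * (t2 - t1) = \int[lebesgue_measure]_(u in `]t1, t2]) m.
  move=> t12; rewrite Rintegral_cst//; congr (m * _).
  have -> : t2 - t1 = fine (if (t1%:E < t2%:E)%E then (t2%:E - t1%:E)%E else 0%E).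
    by rewrite lte_fin; case: ltP => //= h; apply/eqP; rewrite subr_eq0 eq_le t12 h.
  by congr fine; exact/esym/lebesgue_measure_itv.
have intmc t1 t2 (m : R) : lebesgue_measure.-integrable `]t1, t2] (EFin \o cst m).
  apply: (@integrableS _ _ _ lebesgue_measure `[t1, t2]%classic) => //.
    by apply: subset_itvr; rewrite bnd_simp.
  apply: continuous_compact_integrable; first exact: segment_compact.
  by apply: continuous_subspaceT => u; exact: cvg_cst.
split => //; split => t1 t2 m st1 t12 H; rewrite incr// intC//.
  apply: le_Rintegral => //; [exact: intmc|exact: intS|].
  by move=> u /=; rewrite in_itv/= => /andP[h1 h2]; apply: H => //; exact: ltW.
apply: le_Rintegral => //; [exact: intS|exact: intmc|].
by move=> u /=; rewrite in_itv/= => /andP[h1 h2]; apply: H => //; exact: ltW.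
Qed.

Lemma blowup_or_cvg0 (sigma s x0 : R) (w : R -> R) (X : R -> \bar R) :
  0 <= s -> 0 < sigma -> cont_from 0 w -> increments_small w ->
  is_solution sigma w s x0 X -> ~ trapped s x0 sigma w ->
  (blowup_time s X < +oo)%E \/ X t @[t --> +oo] --> 0%E.
Proof.
move=> s0 sigma0 cw ws sX ntr.
have [bX|] := ltP (blowup_time s X) +oo%E; [by left|rewrite leye_eq => /eqP bX; right].
have [fX Xs sol] := is_solution_solves sX bX.
have csw : cont_from s (fun t => sigma * w t).
  move=> t st e e0; have [d d0 H] := cw t (le_trans s0 st) _ (divr_gt0 e0 sigma0).
  exists d => // u su ud; rewrite -mulrBr normrM gtr0_norm// mulrC -ltr_pdivlMr//.
  by apply: H => //; exact: le_trans su.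
have [c0|near_diag] := tends_to_0_or_near_diagonal sol (tame_of_increments cw sigma0
  ws) csw.
  apply/fine_cvgP; split.
    by near=> t; apply: fX; near: t; exact/nbhs_pinfty_ge/num_real.
  apply/cvgrPdist_lt => e e0; have [T HT] := c0 e e0.
  near=> t; rewrite sub0r normrN; apply: HT; near: t; exact/nbhs_pinfty_ge/num_real.
by exfalso; apply: ntr; exact: euler_trapped sol Xs near_diag.
Unshelve. all: by end_near. Qed.

End pathwise.

Theorem theorem4p5 (R : realType) (d : measure_display)
    (Omega : measurableType d) (P : probability Omega R)
    (W : R -> {RV P >-> R}) (sigma : R)
    (X : R -> R -> R -> Omega -> \bar R) :
  is_wiener W -> 0 < sigma ->
  (forall s x : R, 0 <= s ->
    {ae P, forall w, is_solution sigma (fun t => W t w) s x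
                       (fun t => X s x t w)}) ->
  forall s x : R, 0 <= s ->
    {ae P, forall w,
      (blowup_time s (fun t => X s x t w) < +oo)%E \/
      X s x t w @[t --> +oo] --> 0%E}.
Proof.
move=> [_ Wc Wg Wi] sigma0 HX s x s0.
have ntr : {ae P, forall w, ~ trapped s x sigma (sample_path W w)}.
  exists [set w | trapped s x sigma (sample_path W w)]; split.
  - by have [] := cm_trapped x sigma s0 Wg Wi 0.
  - exact: trapped_null.
  - by move=> w /= /contrapT.
(* The exceptional set is only included in a union of four negligible sets; it is not itself known
   to be measurable. *)
apply: negligibleS (negligibleU (negligibleU Wc (ae_increments_small Wg))
  (negligibleU (HX s x s0) ntr)) => w /= nC; apply: contrapT => /not_orP[].
move=> /not_orP[/contrapT cw /contrapT ws] /not_orP[/contrapT sX /contrapT nt]; apply: nC.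
apply: (@blowup_or_cvg0 R sigma s x (fun t => W t w)) => //.
by apply: cont_from_within cw; apply/seteqP; split => t /=; rewrite in_itv/= andbT.
Qed.
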